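(* Let $n,m,k$ be positive integers. Then, with all ideals taken in $A=\mathbb{F}_2[t_1,\ldots,t_k]$: (a) if $\prod_{1\le i<j\le k}(t_i+t_j)^{2m}\notin\langle t_1^n,\ldots,t_k^n\rangle$, then $(n,m,k)\in\mathcal{R}_{odd}$; (b) if $\prod_{1\le i<j\le k}(t_i+t_j)^{m}\notin\langle t_1^n,\ldots,t_k^n\rangle$, then $(n,m,k)\in\mathcal{R}_{odd,sym}$; (c) if $\prod_{1\le i<j\le k}(t_i+t_j)^{2m}\notin\langle \bar w_{n-k+1},\ldots,\bar w_n\rangle$, then $(n,m,k)\in\mathcal{R}_{odd}^{orth}$; (d) if $\prod_{1\le i<j\le k}(t_i+t_j)^{m}\notin\langle \bar w_{n-k+1},\ldots,\bar w_n\rangle$, then $(n,m,k)\in\mathcal{R}_{odd,sym}^{orth}$.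
   Context: A continuous function $f:S^{n-1}\times S^{n-1}\to\mathbb{R}$ is called odd if $f(-x,y)=-f(x,y)$ and $f(x,-y)=-f(x,y)$ for all $x,y\in S^{n-1}$, and symmetric if $f(x,y)=f(y,x)$ for all $x,y\in S^{n-1}$. $\mathcal{R}_{odd}$ (respectively $\mathcal{R}_{odd,sym}$) is the set of triples $(n,m,k)$ of positive integers such that for any $m$ odd (respectively odd and symmetric) functions $f_1,\ldots,f_m:S^{n-1}\times S^{n-1}\to\mathbb{R}$ there exist $k$ unit vectors $e_1,\ldots,e_k\in\mathbb{R}^n$ with $f_l(e_i,e_j)=0$ for all $1\le l\le m$ and $1\le i<j\le k$. $\mathcal{R}_{odd}^{orth}$ (respectively $\mathcal{R}_{odd,sym}^{orth}$) is defined in the same way, with the additional requirement that $(e_1,\ldots,e_k)$ be an orthonormal $k$-frame in $\mathbb{R}^n$. $A=\mathbb{F}_2[t_1,\ldots,t_k]$ is the polynomial algebra with $\deg t_i=1$; $w_1=t_1+\cdots+t_k,\ldots,w_k=t_1\cdots t_k$ are the elementary symmetric polynomials in $t_1,\ldots,t_k$. For $l\ge1$, $$\bar w_l=\sum_{\substack{i_1,\ldots,i_k\ge0\\ i_1+2i_2+\cdots+ki_k=l}}\binom{i_1+\cdots+i_k}{i_1\ i_2\ \ldots\ i_k}\,w_1^{i_1}\cdots w_k^{i_k}\in A,$$ where $\binom{i_1+\cdots+i_k}{i_1\ \ldots\ i_k}=\frac{(i_1+\cdots+i_k)!}{i_1!\cdots i_k!}$ is taken modulo $2$. Conventions: $\bar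 w_0=1$ and $\bar w_l=0$ for $l<0$. *)

(* Defs.v *)
From HB Require Import structures.
From mathcomp Require Import all_boot all_order all_algebra.
From mathcomp Require mpoly.
From mathcomp Require all_classical all_reals all_analysis.

Set Implicit Arguments.
Unset Strict Implicit.
Unset Printing Implicit Defensive.

Import Order.TTheory GRing.Theory Num.Theory.

Local Open Scope ring_scope.

Definition ideal_gen (B : comNzRingType) (r : nat) (g : 'I_r -> B) (p : B) :
  Prop := exists q : 'I_r -> B, p = \sum_(i < r) q i * g i.

(* The notations of mpoly clash with those of mathcomp-analysis: mpoly is only
   imported inside this module. *)
Module PolyF2.
Import mpoly.

(* Packed with its ring structure, so that the ring operations can be used
   without importing mpoly. *)
Definition A (k : nat) : comNzRingType := {mpoly 'F_2[k]}.

Definition t (k : nat) (i : 'I_k) : A k := 'X_i.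

Definition w (k j : nat) : A k := mesym k 'F_2 j.

Definition multinomial (k : nat) (a : 'X_{1..k}) : nat :=
  (mdeg a)`! %/ \prod_(j < k) (a j)`!.

(* Since j : 'I_k is numbered from 0, [a j] is the exponent of w_(j+1), and
   [mnmwgt a] is \sum_j (j+1) * a j.  The latter is at least [mdeg a], so the
   degree bound d.+1 excludes no solution of [mnmwgt a = d]. *)
Definition wbar (k : nat) (l : int) : A k :=
  match l with
  | Posz d => \sum_(a : 'X_{1..k < d.+1} | mnmwgt a == d)
                (multinomial a)%:R * \prod_(j < k) w k j.+1 ^+ a j
  | Negz _ => 0
  end.

Lemma wbar0 (k : nat) : wbar k 0 = 1.
Proof.
have lt01 : (mdeg (0%MM : 'X_{1..k}) < 1)%N by rewrite mdeg0.
rewrite -[0]/(Posz 0) /wbar (big_pred1 (BMultinom lt01)) => [|a] /=.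
  rewrite /multinomial mdeg0 !big1 ?divn1 ?mulr1 // => i _.
    by rewrite mnm0E.
  by rewrite mnm0E.
rewrite -val_eqE /=; apply/eqP/eqP => [wa|->]; last exact: mnmwgt0.
have := leq_mdeg_mnmwgt a; rewrite wa leqn0 mdeg_eq0.
by move/eqP.
Qed.

(* n - k + 1 is an integer, possibly negative: no truncated subtraction. *)
Definition wbar_gens (n k : nat) (i : 'I_k) : A k :=
  wbar k (n%:Z - k%:Z + 1 + i%:Z).

End PolyF2.

Import all_classical all_reals all_analysis.
Import numFieldNormedType.Exports.

Local Open Scope classical_set_scope.

Definition dotv (R : realType) (n : nat) (u v : 'rV[R]_n) : R :=
  \sum_(i < n) u 0 i * v 0 i.

(* The Euclidean sphere S^(n-1) of R^n; the library norm on 'rV[R]_n is the sup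
   norm, which induces the same topology. *)
Definition usphere (R : realType) (n : nat) : set 'rV[R]_n :=
  [set x | dotv x x = 1].
Arguments usphere R n _ : clear implicits.

(* A function on S^(n-1) x S^(n-1) is represented by a total function on
   R^n x R^n, of which only the values on S^(n-1) x S^(n-1) matter. *)
Definition odd_fun (R : realType) (n : nat) (f : 'rV[R]_n * 'rV[R]_n -> R) :
    Prop :=
  [/\ {within usphere R n `*` usphere R n, continuous f},
      {in usphere R n &, forall x y, f (- x, y) = - f (x, y)} &
      {in usphere R n &, forall x y, f (x, - y) = - f (x, y)}].

Definition sym_fun (R : realType) (n : nat) (f : 'rV[R]_n * 'rV[R]_n -> R) :
    Prop :=
  {in usphere R n &, forall x y, f (x, y) = f (y, x)}.

Definition common_zero (R : realType) (n m k : nat)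
    (f : 'I_m -> 'rV[R]_n * 'rV[R]_n -> R) (e : 'I_k -> 'rV[R]_n) : Prop :=
  forall (l : 'I_m) (i j : 'I_k), (i < j)%N -> f l (e i, e j) = 0.

Definition orthonormal_frame (R : realType) (n k : nat)
    (e : 'I_k -> 'rV[R]_n) : Prop :=
  forall i j : 'I_k, dotv (e i) (e j) = (i == j)%:R.

Definition positive_triple (n m k : nat) : Prop :=
  [/\ (0 < n)%N, (0 < m)%N & (0 < k)%N].

Definition R_odd (R : realType) : set (nat * nat * nat) :=
  [set nmk | let: (n, m, k) := nmk in
    positive_triple n m k /\
    forall f : 'I_m -> 'rV[R]_n * 'rV[R]_n -> R,
      (forall l, odd_fun (f l)) ->
      exists e : 'I_k -> 'rV[R]_n,
        (forall i, usphere R n (e i)) /\ common_zero f e].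

Definition R_odd_sym (R : realType) : set (nat * nat * nat) :=
  [set nmk | let: (n, m, k) := nmk in
    positive_triple n m k /\
    forall f : 'I_m -> 'rV[R]_n * 'rV[R]_n -> R,
      (forall l, odd_fun (f l)) -> (forall l, sym_fun (f l)) ->
      exists e : 'I_k -> 'rV[R]_n,
        (forall i, usphere R n (e i)) /\ common_zero f e].

Definition R_odd_orth (R : realType) : set (nat * nat * nat) :=
  [set nmk | let: (n, m, k) := nmk in
    positive_triple n m k /\
    forall f : 'I_m -> 'rV[R]_n * 'rV[R]_n -> R,
      (forall l, odd_fun (f l)) ->
      exists e : 'I_k -> 'rV[R]_n,
        [/\ forall i, usphere R n (e i), orthonormal_frame e & common_zero f e]].

Definition R_odd_sym_orth (R : realType) : set (nat * nat * nat) :=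
  [set nmk | let: (n, m, k) := nmk in
    positive_triple n m k /\
    forall f : 'I_m -> 'rV[R]_n * 'rV[R]_n -> R,
      (forall l, odd_fun (f l)) -> (forall l, sym_fun (f l)) ->
      exists e : 'I_k -> 'rV[R]_n,
        [/\ forall i, usphere R n (e i), orthonormal_frame e & common_zero f e]].

(* Main.v *)
Require Import Defs.
From mathcomp Require Import all_boot all_order all_algebra.
From mathcomp Require Import zify ring.
From mathcomp Require mpoly.
From mathcomp Require boolp.

(** The symmetry hypotheses play no role, and only the pairs [i < j] have to be
    treated; so everything follows from two statements, with
    [Delta = \prod_(i < j) (t_i + t_j)]:
    - if [Delta ^+ m] is not in [<t_1^n, ..., t_k^n>], then [m] odd functions
      have a common zero on a [k]-tuple of unit vectors ([sphere_common_zero]);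
    - if [Delta ^+ m] is not in [<wbar_(n-k+1), ..., wbar_n>], the tuple can be
      taken orthonormal ([frame_common_zero]).

    The second statement reduces to the first one.  Orthogonality of [e_i] and
    [e_j] is the vanishing of one more odd function, the scalar product, so it
    is enough that [Delta ^+ m.+1] is not in [<t_i^n>], and this follows from
    the algebraic fact ([vandermonde_colon]) that [Delta * p] in [<t_i^n>]
    forces [p] in [<wbar_(n-k+1), ..., wbar_n>].  Here [wbar_l] is the complete
    symmetric polynomial [h_l(t_1, ..., t_k)] modulo 2 ([wbar_csym]).  Modulo
    the ideal, [p] can be replaced by a polynomial [p'] whose monomials [t^a]
    satisfy [a_i <= n - 1 - (k - i)] ([reduction]), because the ideal contains
    [h_(n-k+i)(t_i, ..., t_k)], with leading monomial [t_i^(n-k+i)]; moreover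
    [Delta * h_l] lies in [<t_i^n>] for [l + k - 1 >= n].  If [p'] is not zero,
    the leading monomial of [Delta * p'] has all its exponents smaller than
    [n], so [Delta * p'] is not in [<t_i^n>].

    The first statement is a Borsuk-Ulam theorem for products of spheres. A
    closed hemisphere of [S^d], [d = n - 1], is a cube [[-1, 1]^d] on whose
    boundary [x => - x] is the antipode, so it suffices to find a common zero
    of functions on a product of [k] such cubes, each function being even or
    odd under the antipode of the boundary of each cube ([borsuk_ulam_cubes]).
    By compactness this follows from a Tucker lemma ([tucker]) on a fine grid
    whose vertices are labelled by the signs of the functions.

    The Tucker lemma is a cup product computation. A sign labelling [s] of the
    vertices is antisymmetric under the boundary antipodes according to a
    character [chi], and its coboundary is a cocycle representing
    [\sum_i chi_i t_i] on the quotient. Edges of the grid are oriented from even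
    to odd coordinates, which is compatible with the antipodes, and the maximal
    oriented paths are the maximal simplices, with ordered vertices, of a
    triangulation. The cup product of the cocycles of [s_1, ..., s_M] is
    evaluated by counting modulo 2 the paths [v_0 -> ... -> v_M] with
    [s_j(v_(j-1)) <> s_j(v_j)] for all [j]. In operator form, let [edge_sum]
    be the sum over the outgoing edges, and [cup s] its commutator with the
    multiplication by [s]; then [edge_sum \o edge_sum = 0] modulo 2, hence
    [edge_sum] commutes with [cup s], and the count depends only on the
    characters ([sum_cups_homotopy]). For the labellings by lexicographic
    signs in each cube it can be computed: it is the coefficient of
    [\prod_i t_i^d] in [\prod_j \sum_i chi_(j,i) t_i] ([cups_std], [sum_theta]). *)

Set Implicit Arguments.
Unset Strict Implicit.
Unset Printing Implicit Defensive.

Import Order.TTheory GRing.Theory.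
Local Open Scope ring_scope.

(** * Finitely generated ideals *)

Section Ideal.
Variables (Q : comNzRingType) (r : nat) (g : 'I_r -> Q).

Lemma ideal_gen0 : ideal_gen g 0.
Proof. by exists (fun=> 0); rewrite big1 // => i _; rewrite mul0r. Qed.

Lemma ideal_genD p q : ideal_gen g p -> ideal_gen g q -> ideal_gen g (p + q).
Proof.
move=> [a ->] [b ->]; exists (fun i => a i + b i).
by rewrite -big_split; apply: eq_bigr => i _; rewrite mulrDl.
Qed.

Lemma ideal_genM p q : ideal_gen g q -> ideal_gen g (p * q).
Proof.
move=> [a ->]; exists (fun i => p * a i).
by rewrite mulr_sumr; apply: eq_bigr => i _; rewrite mulrA.
Qed.

Lemma ideal_genN p : ideal_gen g p -> ideal_gen g (- p).
Proof. by rewrite -mulN1r; apply: ideal_genM. Qed.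

Lemma ideal_gen_sum (I : eqType) (s : seq I) (P : pred I) (f : I -> Q) :
  (forall i, i \in s -> P i -> ideal_gen g (f i)) -> ideal_gen g (\sum_(i <- s | P i) f i).
Proof.
elim: s => [|i s IH] h; first by rewrite big_nil; apply: ideal_gen0.
rewrite big_cons; case: ifP => Pi; last first.
  by apply: IH => j js; apply: h; rewrite inE js orbT.
apply: ideal_genD; first by apply: h; rewrite ?inE ?eqxx.
by apply: IH => j js; apply: h; rewrite inE js orbT.
Qed.

Lemma ideal_gen_gen i : ideal_gen g (g i).
Proof.
exists (fun j => (j == i)%:R); rewrite (bigD1 i) //= eqxx mul1r big1 ?addr0 //.
by move=> j /negPf->; rewrite mul0r.
Qed.

End Ideal.

(** * Cochains on a grid in a product of cubes *)

Section Grid.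
Variables (k d L : nat).

(** Coordinates on a subdivided edge of the cube: the integers of
    [0, 4 (L + 1)].  The centre [2 (L + 1)] and both ends are even. *)
Definition coord := 'I_(4 * L.+1).+1.

(** Vertices of the grid in the product of [k] cubes of dimension [d]. *)
Definition vertex := {ffun 'I_k * 'I_d -> coord}.

(** Edges are oriented from the even to the odd coordinate. *)
Definition adj (g h : coord) : bool :=
  ~~ odd g && ((h == g.+1 :> nat) || (g == h.+1 :> nat)).

Definition upd (v : vertex) p g : vertex :=
  [ffun q => if q == p then g else v q].

(** The antipode of the [i]-th cube. *)
Definition neg (i : 'I_k) (v : vertex) : vertex :=
  [ffun q => if q.1 == i then rev_ord (v q) else v q].

Definition extreme (g : coord) : bool := (g == 0%N :> nat) || (g == 4 * L.+1 :> nat)%N.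

(** The [i]-th component lies on the boundary of its cube. *)
Definition on_boundary (i : 'I_k) (v : vertex) : bool :=
  [exists c : 'I_d, extreme (v (i, c))].

Definition nearby n (v w : vertex) :=
  forall p, (v p <= w p + n)%N /\ (w p <= v p + n)%N.

Lemma updE v p g q : upd v p g q = if q == p then g else v q.
Proof. by rewrite ffunE. Qed.

Lemma upd_upd v p g h : upd (upd v p g) p h = upd v p h.
Proof. by apply/ffunP => q; rewrite !updE; case: eqP. Qed.

Lemma upd_id v p : upd v p (v p) = v.
Proof. by apply/ffunP => q; rewrite !updE; case: eqP => // ->. Qed.

Lemma updC v p q g h : p != q -> upd (upd v p g) q h = upd (upd v q h) p g.
Proof.
move=> pq; apply/ffunP => r; rewrite !updE.
by case: (r =P q) => // ->; rewrite eq_sym (negPf pq).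
Qed.

Lemma upd_neg i v q g :
  upd (neg i v) q g = neg i (upd v q (if q.1 == i then rev_ord g else g)).
Proof.
apply/ffunP => r; rewrite !ffunE; case: (r =P q) => // ->.
by case: eqP => // _; rewrite rev_ordK.
Qed.

Lemma adj_rev g h : adj (rev_ord g) (rev_ord h) = adj g h.
Proof. by rewrite /adj /=; have := ltn_ord g; have := ltn_ord h; lia. Qed.

Lemma extreme_rev g : extreme (rev_ord g) = extreme g.
Proof. by rewrite /extreme /=; have := ltn_ord g; lia. Qed.

Lemma negK i : involutive (neg i).
Proof.
by move=> v; apply/ffunP => q; rewrite !ffunE; case: eqP => //; rewrite rev_ordK.
Qed.

Lemma extreme_neg i (v : vertex) p : extreme (neg i v p) = extreme (v p).
Proof. by rewrite ffunE; case: eqP => // _; rewrite extreme_rev. Qed.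

Lemma extreme_on_boundary (v : vertex) p : extreme (v p) -> on_boundary p.1 v.
Proof. by case: p => i c h; apply/existsP; exists c. Qed.

(** The ends being even, an edge with its target in a face of the cube
    has its source in the same face. *)
Lemma extreme_upd (v : vertex) p q g : adj (v q) g -> extreme (upd v q g p) -> extreme (v p).
Proof. by rewrite updE; case: eqP => // ->; rewrite /adj /extreme; lia. Qed.

Definition centre := (2 * L.+1)%N.

(** The number of initial coordinates of the [i]-th component that are
    central. *)
Definition lead_zeros (v : vertex) (i : 'I_k) : nat :=
  find (fun c : 'I_d => v (i, c) != centre :> nat) (enum 'I_d).

(** The [i]-th component is lexicographically negative: its first
    non-central coordinate exists and is smaller than the centre. *)
Definition lex_neg (i : 'I_k) (v : vertex) : bool :=
  [exists c : 'I_d, (c == lead_zeros v i :> nat) && (v (i, c) < centre)%N].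

Lemma lead_zerosP v i :
  [/\ (lead_zeros v i <= d)%N,
      forall c : 'I_d, (c < lead_zeros v i)%N -> v (i, c) = centre :> nat
    & forall c : 'I_d, c = lead_zeros v i :> nat -> v (i, c) != centre :> nat].
Proof.
have sz : size (enum 'I_d) = d by rewrite size_enum_ord.
split; first by rewrite -[X in (_ <= X)%N]sz find_size.
  move=> c /(before_find c) /=; rewrite nth_ord_enum.
  by move/negbFE/eqP.
move=> c e.
have := nth_find c (a := fun c : 'I_d => v (i, c) != centre :> nat) (s := enum 'I_d).
rewrite -/(lead_zeros v i) -e nth_ord_enum; apply.
by rewrite has_find -/(lead_zeros v i) -e sz.
Qed.

Lemma lead_zeros_uniq (v : vertex) i n : (n <= d)%N ->
  (forall c : 'I_d, (c < n)%N -> v (i, c) = centre :> nat) ->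
  (forall c : 'I_d, c = n :> nat -> v (i, c) != centre :> nat) -> lead_zeros v i = n.
Proof.
move=> nd h1 h2; have [zd z1 z2] := lead_zerosP v i.
have [lt|lt|//] := ltngtP (lead_zeros v i) n.
  have ltd : (lead_zeros v i < d)%N by lia.
  by have := z2 (Ordinal ltd) erefl; rewrite h1 ?eqxx.
have ltd : (n < d)%N by lia.
by have := h2 (Ordinal ltd) erefl; rewrite z1 ?eqxx.
Qed.

Lemma lead_zeros_eq (v w : vertex) i :
  (forall c, v (i, c) = w (i, c)) -> lead_zeros v i = lead_zeros w i.
Proof. by move=> e; apply: eq_find => c; rewrite e. Qed.

Lemma lex_negE (v : vertex) i (c : 'I_d) :
  c = lead_zeros v i :> nat -> lex_neg i v = (v (i, c) < centre)%N.
Proof.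
move=> e; apply/existsP/idP => [[c' /andP[/eqP e' lt]]|lt].
  by rewrite (_ : c = c') //; apply: val_inj; rewrite /= e e'.
by exists c; rewrite e eqxx.
Qed.

Lemma lex_neg_eq (v w : vertex) i :
  (forall c, v (i, c) = w (i, c)) -> lex_neg i v = lex_neg i w.
Proof. by move=> e; apply: eq_existsb => c; rewrite e (lead_zeros_eq e). Qed.

Lemma sum_bin z m : (z <= d)%N -> \sum_(c < d | (c < z)%N) 'C(c, m) = 'C(z, m.+1).
Proof.
move=> zd; rewrite -(big_ord_widen _ (fun c => 'C(c, m))) //.
elim: z {zd} => [|z IH]; first by rewrite big_ord0.
by rewrite big_ord_recr /= IH binS.
Qed.

Section Cochains.
Variable F : comNzRingType.
Implicit Types (f : vertex -> F) (v : vertex).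

(** A labelling with character [chi]: the antipode of the [i]-th cube adds
    [chi i] to the labels of the vertices in the boundary of that cube. *)
Definition labelling (chi : 'I_k -> F) (s : vertex -> F) :=
  forall i v, on_boundary i v -> s (neg i v) = s v + chi i.

(** Sum over the edges with source [v] in direction [p]. *)
Definition step (p : 'I_k * 'I_d) (f : vertex -> F) (v : vertex) :=
  \sum_(g | adj (v p) g) f (upd v p g).

(** Sum over the edges with source [v]. *)
Definition edge_sum (f : vertex -> F) (v : vertex) := \sum_p step p f v.

(** The sum over the edges [v -> w] weighted by [s v + s w], see [cupE]; in
    characteristic 2 the weight is the coboundary of [s], and the operator
    [cup s] is the commutator of [edge_sum] and of the multiplication by [s]. *)
Definition cup (s f : vertex -> F) (v : vertex) :=
  s v * edge_sum f v + edge_sum (fun w => s w * f w) v.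

(** Functions supported in the pair of opposite faces [v p = 0] and
    [v p = 4 (L + 1)], and invariant under the antipode of the cube of [p]. *)
Definition face_inv (p : 'I_k * 'I_d) (f : vertex -> F) :=
  (forall v : vertex, ~~ extreme (v p) -> f v = 0) /\ (forall v, f (neg p.1 v) = f v).

Lemma cupE s f v :
  cup s f v = \sum_p \sum_(g | adj (v p) g) (s v + s (upd v p g)) * f (upd v p g).
Proof.
rewrite /cup /edge_sum mulr_sumr -big_split; apply: eq_bigr => p _.
rewrite /step mulr_sumr -big_split; apply: eq_bigr => g _.
by rewrite mulrDl.
Qed.

Lemma step_step p f v : step p (step p f) v = 0.
Proof.
rewrite /step big1 // => g adjg; rewrite big1 // => h.
by move: adjg; rewrite updE eqxx /adj; lia.
Qed.

Lemma stepC p q f v : step p (step q f) v = step q (step p f) v.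
Proof.
have [->//|pq] := eqVneq p q.
rewrite /step.
under eq_bigr => g _ do under eq_bigl => h do
  rewrite updE eq_sym (negPf pq).
rewrite exchange_big /=.
under [RHS]eq_bigr => g _ do under eq_bigl => h do
  rewrite updE (negPf pq).
by apply: eq_bigr => g _; apply: eq_bigr => h _; rewrite updC.
Qed.

Lemma edge_sum_sum (I : Type) (r : seq I) P (H : I -> vertex -> F) v :
  edge_sum (fun w => \sum_(i <- r | P i) H i w) v = \sum_(i <- r | P i) edge_sum (H i) v.
Proof.
rewrite /edge_sum exchange_big /=; apply: eq_bigr => p _.
by rewrite /step exchange_big.
Qed.

Lemma edge_sumD f g v : edge_sum (fun w => f w + g w) v = edge_sum f v + edge_sum g v.
Proof.
rewrite /edge_sum -big_split; apply: eq_bigr => p _.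
by rewrite /step -big_split.
Qed.

Lemma cupD s f g v : cup s (fun w => f w + g w) v = cup s f v + cup s g v.
Proof.
rewrite /cup edge_sumD (_ : (fun w => _) = (fun w => s w * f w + s w * g w)); last first.
  by apply: boolp.funext => w; rewrite mulrDr.
by rewrite edge_sumD mulrDr addrACA.
Qed.

Lemma cup_sum s (I : Type) (r : seq I) P (H : I -> vertex -> F) v :
  cup s (fun w => \sum_(i <- r | P i) H i w) v = \sum_(i <- r | P i) cup s (H i) v.
Proof.
rewrite /cup edge_sum_sum big_split mulr_sumr /=; congr (_ + _).
rewrite -edge_sum_sum; congr (edge_sum _ v); apply: boolp.funext => w; exact: mulr_sumr.
Qed.

Lemma cupDl s t f v : cup (fun w => s w + t w) f v = cup s f v + cup t f v.
Proof.
rewrite !cupE -big_split; apply: eq_bigr => p _.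
rewrite -big_split; apply: eq_bigr => g _ /=.
by rewrite -mulrDl addrACA.
Qed.

Lemma cup_suml (I : Type) (r : seq I) P (S : I -> vertex -> F) f v :
  cup (fun w => \sum_(i <- r | P i) S i w) f v = \sum_(i <- r | P i) cup (S i) f v.
Proof.
rewrite /cup big_split mulr_suml /=; congr (_ + _).
rewrite -edge_sum_sum; congr (edge_sum _ v); apply: boolp.funext => w; exact: mulr_suml.
Qed.

Lemma face_inv_mul p u f : labelling (fun=> 0) u ->
  face_inv p f -> face_inv p (fun v => u v * f v).
Proof.
move=> ulab [f0 fneg]; split=> v; first by move/f0->; rewrite mulr0.
have [b|nb] := boolP (extreme (v p)).
  by rewrite fneg ulab ?addr0 //; apply: extreme_on_boundary.
by rewrite !f0 ?mulr0 // extreme_neg.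
Qed.

Section Cups.
Variable T : Type.
Implicit Types (s : T -> vertex -> F) (r : seq T).

(** At [v], and for [f = 1], the sum over the paths [v = v_0 -> v_1 -> ...] of
    the products of the coboundaries of [s a_j] on the edges [v_(j-1) -> v_j],
    where [r = a_1, a_2, ...]. *)
Definition cups s r f := foldr (fun a => cup (s a)) f r.

Lemma cups_rcons s r a f : cups s (rcons r a) f = cups s r (cup (s a) f).
Proof. by rewrite /cups foldr_rcons. Qed.

Lemma cupsD s r f g : cups s r (fun w => f w + g w) =
  fun v => cups s r f v + cups s r g v.
Proof.
elim: r => //= a r ->; apply: boolp.funext => v; exact: cupD.
Qed.

Lemma cups_sum s r (I : Type) (t : seq I) P (H : I -> vertex -> F) :
  cups s r (fun w => \sum_(i <- t | P i) H i w) =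
  fun v => \sum_(i <- t | P i) cups s r (H i) v.
Proof.
elim: r => //= a r ->; apply: boolp.funext => v; exact: cup_sum.
Qed.

End Cups.

(** The iterated cup product of lexicographic signs, [m i] of them in the [i]-th
    cube, see [cup_lex_neg]: a path from [v] whose edges all change the sign in
    their cube is given by the initial central coordinates it moves, which it
    takes in decreasing order in each cube. *)
Definition binprod (m : 'I_k -> nat) (v : vertex) : F :=
  \prod_j ('C(lead_zeros v j, m j))%:R.

Lemma binprod_gt m v i : (d < m i)%N -> binprod m v = 0.
Proof.
move=> lt; rewrite /binprod (bigD1 i) //= bin_small ?mul0r //.
by apply: leq_ltn_trans lt; case: (lead_zerosP v i).
Qed.

Lemma sum_binprod_top m : (forall i, m i = d) -> \sum_v binprod m v = 1.
Proof.
move=> md; have lt : (centre < (4 * L.+1).+1)%N by rewrite /centre; lia.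
rewrite (bigD1 [ffun=> Ordinal lt]) //= [X in _ + X]big1 ?addr0 => [|v vn].
  rewrite /binprod big1 // => i _; rewrite (_ : lead_zeros _ _ = d) ?md ?binn //.
  apply: lead_zeros_uniq => // c; first by rewrite ffunE.
  by move=> e; have := ltn_ord c; rewrite e ltnn.
case: (pickP (fun i => lead_zeros v i != d)) => [i zi|zi].
  rewrite /binprod (bigD1 i) //= md bin_small ?mul0r //.
  by rewrite ltn_neqAle zi; case: (lead_zerosP v i).
case/eqP: vn; apply/ffunP => -[i c]; rewrite ffunE; apply: val_inj => /=.
case: (lead_zerosP v i) => _ h _; apply: h.
by move/negbFE/eqP: (zi i) => ->.
Qed.

Section Char2.
Hypothesis charF : 2%N \in [pchar F].

Let addFF (x : F) : x + x = 0.
Proof. exact: addrr_pchar2. Qed.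

Lemma sum_sym_char2 (I : finType) (G : I -> I -> F) :
  (forall i j, G i j = G j i) -> (forall i, G i i = 0) ->
  \sum_i \sum_j G i j = 0.
Proof.
move=> Gsym G0.
rewrite pair_bigA /=.
rewrite (bigID (fun p : I * I => (enum_rank p.1 < enum_rank p.2)%N)) /=.
rewrite [X in _ + X](bigID (fun p : I * I => (enum_rank p.2 < enum_rank p.1)%N)) /=.
rewrite [X in _ + (_ + X)]big1 ?addr0 => [|[i j] /=]; last first.
  rewrite -!leqNgt => /andP[ij ji].
  suff -> : i = j by [].
  by apply/enum_rank_inj/val_inj/eqP; rewrite eqn_leq ij ji.
set S := \sum_(i | _) _; rewrite [X in _ + X](_ : _ = S) ?addFF //.
rewrite [RHS](reindex_inj (h := fun p : I * I => (p.2, p.1))) /=; last first.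
  by move=> [a b] [c e] [-> ->].
apply: eq_big => [[i j]|[i j] _] //=.
by apply: andb_idl => h; rewrite -leqNgt ltnW.
Qed.

(** Two edges in different directions can be taken in either order, and two
    edges in the same direction never follow each other. *)
Lemma edge_sum2 f v : edge_sum (edge_sum f) v = 0.
Proof.
have -> : edge_sum f = fun w => \sum_p step p f w by [].
rewrite edge_sum_sum /edge_sum; apply: sum_sym_char2 => [p q|p]; first exact: stepC.
exact: step_step.
Qed.

Lemma edge_sum_cup s f v : edge_sum (cup s f) v = cup s (edge_sum f) v.
Proof. by rewrite edge_sumD edge_sum2 addr0 /cup edge_sum2 mulr0 add0r. Qed.

(** Every vertex is the target of an even number of edges. *)
Lemma sum_edge_sum f : \sum_v edge_sum f v = 0.
Proof.
rewrite exchange_big big1 //= => p _.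
rewrite /step.
under eq_bigr => v _ do rewrite big_mkcond.
rewrite pair_bigA /=.
rewrite (reindex_inj (h := fun u : vertex * coord => (upd u.1 p u.2, u.1 p))) /=; last first.
  move=> [v g] [w h] [/ffunP e1 e2]; congr (_, _).
    apply/ffunP => q; move: (e1 q); rewrite !updE; case: eqP => // -> _.
    by rewrite e2.
  by move: (e1 p); rewrite !updE eqxx.
rewrite -(pair_bigA _ (fun v g => if adj (upd v p g p) (v p) then
  f (upd (upd v p g) p (v p)) else 0)) /=.
apply: big1 => v _.
under eq_bigr => g _ do rewrite upd_upd upd_id updE eqxx.
rewrite -big_mkcond sumr_const.
have [ev|od] := boolP (odd (v p)); last first.
  rewrite eq_card0 // => g; rewrite -[LHS]/(adj g (v p)) !inE /adj; lia.
have lt1 : ((v p).-1 < (4 * L.+1).+1)%N by have := ltn_ord (v p); lia.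
have lt2 : ((v p).+1 < (4 * L.+1).+1)%N by have := ltn_ord (v p); lia.
rewrite (@eq_card _ _ [set Ordinal lt1; Ordinal lt2]).
  by rewrite cards2 -val_eqE /=; case: eqP => [|_]; rewrite ?mulr2n ?addFF //; lia.
move=> g; rewrite -[LHS]/(adj g (v p)) !inE -!val_eqE /= /adj; lia.
Qed.

(** In each even coordinate a vertex is the source of two edges, or of one edge
    if the coordinate is extreme. *)
Lemma edge_sum1 v : edge_sum (fun=> 1) v = \sum_p (extreme (v p))%:R.
Proof.
apply: eq_bigr => p _; rewrite /step sumr_const.
have /orP[ev|od] := orbN (odd (v p)).
  rewrite eq_card0; last by move=> g; rewrite -[LHS]/(adj (v p) g) !inE /adj; lia.
  by rewrite /extreme; case: orP => // -[]/eqP; lia.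
have ltv := ltn_ord (v p).
have [b|b] := boolP (extreme (v p)); move: b; rewrite /extreme => b.
  (* The only neighbour of an extreme coordinate: [1] or [4 * L.+1 - 1]. *)
  have lt1 : ((v p == 0%N :> nat) + (v p).-1 < (4 * L.+1).+1)%N by lia.
  rewrite (@eq_card _ _ [set Ordinal lt1]) ?cards1 //.
  move=> g; have := ltn_ord g.
  by rewrite -[X in X = _]/(adj (v p) g) !inE -!val_eqE /= /adj; lia.
have lt1 : ((v p).-1 < (4 * L.+1).+1)%N by lia.
have lt2 : ((v p).+1 < (4 * L.+1).+1)%N by lia.
rewrite (@eq_card _ _ [set Ordinal lt1; Ordinal lt2]).
  by rewrite cards2 -val_eqE /=; case: eqP => [|_]; rewrite ?mulr2n ?addFF //; lia.
move=> g; rewrite -[LHS]/(adj (v p) g) !inE -!val_eqE /= /adj; lia.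
Qed.

Lemma face_inv_cup p chi s f : labelling chi s -> face_inv p f -> face_inv p (cup s f).
Proof.
move=> slab [f0 fneg]; split=> v.
  move=> nb; rewrite cupE big1 // => q _; rewrite big1 // => g adjg.
  by rewrite f0 ?mulr0 //; apply: contra nb; apply: extreme_upd.
set i := p.1 in fneg *; rewrite !cupE; apply: eq_bigr => q _.
rewrite (reindex_inj (h := fun g => if q.1 == i then rev_ord g else g)) /=; last first.
  by move=> g h; case: eqP => // _; apply: rev_ord_inj.
apply: eq_big => g.
  by rewrite ffunE; case: eqP; rewrite ?adj_rev.
have -> : adj (neg i v q) (if q.1 == i then rev_ord g else g) = adj (v q) g.
  by rewrite ffunE; case: eqP; rewrite ?adj_rev.
move=> adjg.
have -> : upd (neg i v) q (if q.1 == i then rev_ord g else g) = neg i (upd v q g).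
  by rewrite upd_neg; congr (neg i (upd v q _)); case: eqP; rewrite ?rev_ordK.
rewrite fneg; have [b|nb] := boolP (extreme (upd v q g p)); last first.
  by rewrite f0 ?mulr0.
have b' := extreme_upd adjg b.
by rewrite !slab ?extreme_on_boundary // addrACA addFF addr0.
Qed.

(** The two opposite faces contribute the same sum. *)
Lemma sum_face_inv p f : face_inv p f -> \sum_v f v = 0.
Proof.
case=> f0 fneg.
rewrite (bigID (fun v : vertex => v p == 0%N :> nat)) /=.
rewrite [X in _ + X](bigID (fun v : vertex => v p == 4 * L.+1 :> nat)%N) /=.
rewrite [X in _ + (_ + X)]big1 ?addr0 => [|v /andP[v0 v1]]; last first.
  by rewrite f0 // /extreme negb_or v0 v1.
rewrite [X in _ + X](reindex_inj (inv_inj (negK p.1))) /=.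
set S := \sum_(i | _) _; rewrite [X in _ + X](_ : _ = S) ?addFF //.
apply: eq_big => // v; rewrite ffunE eqxx /=.
by have := ltn_ord (v p); lia.
Qed.

Section Homotopy.
Variables (T : Type) (chi : T -> 'I_k -> F).
Implicit Types (s : T -> vertex -> F) (r : seq T).

Lemma cups_edge_sum s r f : cups s r (edge_sum f) = edge_sum (cups s r f).
Proof. by elim: r => //= a r ->; apply: boolp.funext => v; rewrite edge_sum_cup. Qed.

Lemma face_inv_cups p s r f : (forall a, labelling (chi a) (s a)) ->
  face_inv p f -> face_inv p (cups s r f).
Proof. by move=> sl gf; elim: r => //= a r; apply: face_inv_cup (sl a). Qed.

(** Cup products with the coboundary of an invariant function have sum zero:
    write [cup u] as a commutator and move [edge_sum] to both ends.  On the
    left it is killed by [sum_edge_sum]; on the right only boundary terms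
    remain, which the antipodes match in pairs. *)
Lemma sum_cups_invariant s s' r r' u : (forall a, labelling (chi a) (s a)) ->
  (forall a, labelling (chi a) (s' a)) -> labelling (fun=> 0) u ->
  \sum_v cups s r (cup u (cups s' r' (fun=> 1))) v = 0.
Proof.
move=> sl sl' ul.
pose G1 v := u v * cups s' r' (edge_sum (fun=> 1)) v.
pose G2 w := u w * cups s' r' (fun=> 1) w.
have -> : cup u (cups s' r' (fun=> 1)) = fun v => G1 v + edge_sum G2 v.
  by rewrite /G1 cups_edge_sum.
rewrite cupsD big_split /= cups_edge_sum sum_edge_sum addr0 /G1.
rewrite (_ : edge_sum (fun=> 1) = fun v : vertex => \sum_p (extreme (v p))%:R); last first.
  by apply: boolp.funext => v; apply: edge_sum1.
rewrite cups_sum.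
rewrite (_ : (fun v => _) = fun v => \sum_p u v *
    cups s' r' (fun w : vertex => (extreme (w p))%:R) v); last first.
  by apply: boolp.funext => v; rewrite mulr_sumr.
rewrite cups_sum exchange_big big1 //= => p _.
apply: (@sum_face_inv p); apply: face_inv_cups => //; apply: face_inv_mul => //.
apply: face_inv_cups => //; split => v; first by move/negPf->.
by rewrite extreme_neg.
Qed.

(** The value of the cup product depends only on the characters: the labellings
    are replaced one at a time, and two labellings with the same character
    differ by an invariant function. *)
Lemma sum_cups_homotopy s s' r : (forall a, labelling (chi a) (s a)) ->
  (forall a, labelling (chi a) (s' a)) ->
  \sum_v cups s r (fun=> 1) v = \sum_v cups s' r (fun=> 1) v.
Proof.
move=> sl sl'.
suff H r0 : \sum_v cups s r0 (cups s r (fun=> 1)) v =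
            \sum_v cups s r0 (cups s' r (fun=> 1)) v by apply: (H [::]).
elim: r r0 => //= a r IH r0.
have := IH (rcons r0 a); rewrite !cups_rcons => ->.
pose u w := s a w + s' a w.
have -> : cup (s a) (cups s' r (fun=> 1)) = fun v =>
    cup (s' a) (cups s' r (fun=> 1)) v + cup u (cups s' r (fun=> 1)) v.
  apply: boolp.funext => v; rewrite -cupDl; congr (cup _ _ v).
  by apply: boolp.funext => w; rewrite /u addrCA addFF addr0.
rewrite cupsD big_split /= (@sum_cups_invariant s s' r0 r u) ?addr0 // => i v b.
by rewrite /u sl // sl' // addrACA addFF.
Qed.

End Homotopy.

Lemma cup_neq0 s f v : cup s f v != 0 ->
  exists w, [/\ nearby 1 v w, s v != s w & f w != 0].
Proof.
rewrite cupE => /eqP nz.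
case: (boolP [exists p, [exists g,
  adj (v p) g && ((s v + s (upd v p g)) * f (upd v p g) != 0)]]).
  case/existsP=> p /existsP[g /andP[adjg nz']].
  exists (upd v p g); split=> //.
  - by move=> q; rewrite updE; case: eqP => [->|]; move: adjg; rewrite /adj; lia.
  - by apply: contra nz' => /eqP->; rewrite addFF mul0r.
  - by apply: contra nz' => /eqP->; rewrite mulr0.
rewrite negb_exists => /forallP h; case: nz; rewrite big1 // => p _.
rewrite big1 // => g adjg; apply/eqP; move: (h p); rewrite negb_exists => /forallP/(_ g).
by rewrite adjg /= negbK.
Qed.

Lemma cups_neq0 (T : eqType) (s : T -> vertex -> F) r f v :
  cups s r f v != 0 ->
  forall a, a \in r -> exists w w',
    [/\ nearby (size r) v w, nearby (size r) v w' & s a w != s a w'].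
Proof.
elim: r v => //= b r IH v /cup_neq0[w [vw sw wn]] a; rewrite inE => /orP[/eqP->|ar].
  exists v, w; split=> // p; first by lia.
  by have := vw p; lia.
have [w1 [w2 [n1 n2 s12]]] := IH _ wn a ar.
exists w1, w2; split=> // p; have := vw p.
  by have := n1 p; lia.
by have := n2 p; lia.
Qed.

Lemma lex_neg_labelling j : labelling (fun i => (i == j)%:R) (fun v => (lex_neg j v)%:R).
Proof.
move=> i v /existsP[c bc] /=; have [<-|ij] := eqVneq i j; last first.
  rewrite addr0 (@lex_neg_eq _ v) // => c'; rewrite ffunE /= eq_sym.
  by rewrite (negPf ij).
have [zd z1 z2] := lead_zerosP v i.
have ltz : (lead_zeros v i < d)%N.
  rewrite ltn_neqAle zd andbT; apply/eqP => e.
  have := z1 c; rewrite e ltn_ord => /(_ isT).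
  by move: bc; rewrite /extreme /centre; set x := nat_of_ord _; lia.
have e1 : lead_zeros (neg i v) i = lead_zeros v i.
  apply: lead_zeros_uniq => // c' /=; rewrite ffunE eqxx /= /centre.
    by move/z1; rewrite /centre; lia.
  by move/z2; have := ltn_ord (v (i, c')); rewrite /centre; lia.
rewrite (lex_negE (c := Ordinal ltz)) // (lex_negE (c := Ordinal ltz)) //.
rewrite ffunE eqxx /=; have := z2 (Ordinal ltz) erefl.
set x := v _ => xn.
have -> : (4 * L.+1 - x < centre)%N = ~~ (x < centre)%N.
  by have := ltn_ord x; move: xn; rewrite /centre; lia.
by case: (_ < _)%N; rewrite /= ?addFF ?add0r.
Qed.

Lemma sum_adj_centre (b : F) (g0 : coord) : g0 = centre :> nat ->
  \sum_(g | adj g0 g) (b + (g < centre)%N%:R) = 1.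
Proof.
move=> e0; have lt0 := ltn_ord g0.
have lt1 : (centre.-1 < (4 * L.+1).+1)%N by rewrite /centre; lia.
have lt2 : (centre.+1 < (4 * L.+1).+1)%N by rewrite /centre; lia.
rewrite (eq_bigl (mem [set Ordinal lt1; Ordinal lt2])); last first.
  by move=> g; rewrite /adj !inE -!val_eqE /= e0 /centre; lia.
rewrite big_setU1 ?inE -?val_eqE /=; last by rewrite /centre; lia.
rewrite big_set1 /=.
have -> : (centre.-1 < centre)%N by rewrite /centre; lia.
have -> : (centre.+1 < centre)%N = false by rewrite /centre; lia.
by rewrite addr0 addrAC addFF add0r.
Qed.

(** An edge changes the lexicographic sign of the [i]-th component iff it moves
    one of the initial central coordinates to the appropriate side. *)
Lemma step_lex_neg m i j c (v : vertex) : \sum_(g | adj (v (j, c)) g)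
    ((lex_neg i v)%:R + (lex_neg i (upd v (j, c) g))%:R) * binprod m (upd v (j, c) g) =
  if (j == i) && (c < lead_zeros v i)%N then
    'C(c, m i)%:R * \prod_(j' | j' != i) 'C(lead_zeros v j', m j')%:R else 0.
Proof.
have [->|ji] /= := eqVneq j i; last first.
  rewrite big1 // => g _; rewrite (@lex_neg_eq (upd _ _ _) v) ?addFF ?mul0r // => c'.
  by rewrite updE xpair_eqE eq_sym (negPf ji).
have [zd z1 z2] := lead_zerosP v i.
have [cz|cz] := ltnP.
  set Q := _ * _; rewrite -[Q]mul1r -[X in X * Q](@sum_adj_centre (lex_neg i v)%:R _ (z1 _ cz)).
  rewrite mulr_suml.
  apply: eq_bigr => g adjg.
  have ez : lead_zeros (upd v (i, c) g) i = c.
    apply: lead_zeros_uniq => [|c' lt|c' /val_inj ->]; first exact: ltnW.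
      rewrite updE xpair_eqE eqxx /= -val_eqE /=.
      by rewrite ltn_eqF // z1 //; lia.
    by rewrite updE eqxx; move: adjg (z1 _ cz); rewrite /adj; lia.
  rewrite (lex_negE (esym ez)) updE eqxx; congr (_ * _).
  rewrite /binprod /Q (bigD1 i) //= ez; congr (_ * _); apply: eq_bigr => j' j'i.
  rewrite (@lead_zeros_eq _ v) // => c'; rewrite updE xpair_eqE (negPf j'i) //.
rewrite big1 // => g adjg.
rewrite (_ : lex_neg i (upd v (i, c) g) = lex_neg i v) ?addFF ?mul0r //.
have ez : lead_zeros (upd v (i, c) g) i = lead_zeros v i.
  apply: lead_zeros_uniq => // c' e; rewrite updE xpair_eqE eqxx -val_eqE /=.
    by rewrite ltn_eqF ?z1 //; apply: leq_trans cz.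
  case: ifP => [/eqP ec|_]; last exact: z2.
  move: (z2 c' e); rewrite (_ : c' = c); last exact: val_inj.
  by move: adjg; rewrite /adj /centre; lia.
have [ltz|] := ltnP (lead_zeros v i) d; last first.
  by move=> le; have := ltn_ord c; lia.
rewrite !(lex_negE (c := Ordinal ltz)) ?ez // updE xpair_eqE eqxx -val_eqE /=.
case: ifP => // /eqP e; rewrite (_ : Ordinal ltz = c); last exact: val_inj.
by move: adjg (z2 c (esym e)); rewrite /adj /centre; lia.
Qed.

Lemma cup_lex_neg m i v :
  cup (fun w => (lex_neg i w)%:R) (binprod m) v = binprod (fun j => (i == j) + m j)%N v.
Proof.
rewrite cupE.
pose G j (c : 'I_d) : F := if (j == i) && (c < lead_zeros v i)%N then
  'C(c, m i)%:R * \prod_(j' | j' != i) 'C(lead_zeros v j', m j')%:R else 0.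
rewrite (eq_bigr (fun p => G p.1 p.2)) => [|[j c] _]; last exact: step_lex_neg.
rewrite -(pair_bigA _ G) /= /G.
rewrite (bigD1 i) //= [X in _ + X]big1 ?addr0 => [|j /negPf ji]; last first.
  by rewrite big1 // => c _; rewrite ji.
rewrite eqxx /= -big_mkcond -mulr_suml -natr_sum sum_bin; last by case: (lead_zerosP v i).
rewrite /binprod [RHS](bigD1 i) //= eqxx add1n; congr (_ * _).
by apply: eq_bigr => j ji; rewrite eq_sym (negPf ji).
Qed.

End Char2.
End Cochains.
End Grid.

(** * The Tucker lemma for products of cubes *)

Lemma pchar_F2 : 2%N \in [pchar 'F_2].
Proof. by rewrite pchar_Fp. Qed.

Module Tucker.
Import mpoly.

Section Theta.
Variables (k d L : nat).
Local Notation A := {mpoly 'F_2[k]}.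
Local Notation vertex := (vertex k d L).

(** Monomials with all exponents at most [d]. *)
Definition box (a : {ffun 'I_k -> 'I_d.+1}) : 'X_{1..k} := [multinom (a i : nat) | i < k].

(** The linear map sending a monomial [X^m] to [binprod m] ([thetaX]); the
    monomials with an exponent larger than [d] are sent to zero.  It turns the
    multiplication by a variable into a cup product ([cup_theta]). *)
Definition theta (q : A) (v : vertex) : 'F_2 :=
  \sum_a q@_(box a) * binprod 'F_2 (box a) v.

Lemma theta_lin c p q v : theta (c *: p + q) v = c * theta p v + theta q v.
Proof.
rewrite /theta mulr_sumr -big_split; apply: eq_bigr => a _.
by rewrite mcoeffD mcoeffZ mulrDl mulrA.
Qed.

Lemma theta0 v : theta 0 v = 0.
Proof. by rewrite /theta big1 // => a _; rewrite mcoeff0 mul0r. Qed.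

Lemma thetaD p q v : theta (p + q) v = theta p v + theta q v.
Proof. by rewrite -{1}[p]scale1r theta_lin mul1r. Qed.

Lemma theta_sum (I : Type) (r : seq I) (P : pred I) (f : I -> A) v :
  theta (\sum_(i <- r | P i) f i) v = \sum_(i <- r | P i) theta (f i) v.
Proof. exact: (big_morph (theta^~ v) (fun p q => thetaD p q v) (theta0 v)). Qed.

Lemma thetaX m v : theta 'X_[m] v = binprod 'F_2 m v.
Proof.
case: (pickP (fun i => d < m i)%N) => [i lti|le].
  rewrite (binprod_gt _ _ lti) /theta big1 // => a _; rewrite mcoeffX.
  case: eqP => [e|_]; last by rewrite mul0r.
  by move: lti; rewrite e mnmE ltnNge -ltnS ltn_ord.
rewrite /theta (bigD1 [ffun i => inord (m i)]) //= mcoeffX.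
have e : m = box [ffun i => inord (m i)].
  apply/mnmP => i; rewrite mnmE ffunE inordK //.
  by rewrite ltnS leqNgt le.
rewrite -e eqxx mul1r big1 ?addr0 // => a an.
rewrite mcoeffX; case: eqP => [e'|_]; last by rewrite mul0r.
case/eqP: an; apply/ffunP => i; rewrite ffunE e' mnmE.
by apply: val_inj; rewrite /= inordK //.
Qed.

Lemma cup_theta i q v :
  cup (fun w => (lex_neg i w)%:R) (theta q) v = theta ('X_i * q) v.
Proof.
elim/mpolyind: q v => [|c m p _ _ IH] v.
  rewrite mulr0 theta0 cupE big1 // => p _; rewrite big1 // => g _.
  by rewrite theta0 mulr0.
rewrite mulrDr -scalerAr theta_lin -mpolyXD thetaX.
rewrite -IH.
have -> : theta (c *: 'X_[m] + p) = fun w => c * binprod 'F_2 m w + theta p w.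
  by apply: boolp.funext => w; rewrite theta_lin thetaX.
rewrite cupD; congr (_ + _).
transitivity (c * cup (fun w => (lex_neg i w)%:R) (binprod 'F_2 m) v).
  rewrite !cupE mulr_sumr; apply: eq_bigr => q _.
  by rewrite mulr_sumr; apply: eq_bigr => g _; rewrite mulrCA.
rewrite cup_lex_neg //; congr (_ * _).
by apply: eq_bigr => j _; rewrite mnmDE mnm1E.
Qed.

Section Std.
Variables (T : Type) (chi : T -> 'I_k -> bool).

(** The standard labelling with character [chi a], a sum of lexicographic
    signs. *)
Definition std a (v : vertex) : 'F_2 := \sum_(i | chi a i) (lex_neg i v)%:R.

(** The class of the coboundary of a labelling with character [chi a]. *)
Definition lform a : A := \sum_(i | chi a i) 'X_i.

Lemma std_labelling a : labelling (fun i => (chi a i)%:R) (std a).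
Proof.
move=> i v b; rewrite /std.
under eq_bigr => j _ do rewrite (lex_neg_labelling _ _ b) //.
rewrite big_split /=; congr (_ + _).
case: (boolP (chi a i)) => ci.
  rewrite (bigD1 i) //= eqxx big1 ?addr0 // => j /andP[_ /negPf].
  by rewrite eq_sym => ->.
by rewrite big1 // => j; case: eqP => // <-; rewrite (negPf ci).
Qed.

Lemma cups_std r : cups std r (fun=> 1) = theta (\prod_(a <- r) lform a).
Proof.
elim: r => [|a r IH] /=.
  apply: boolp.funext => v; rewrite big_nil -mpolyX0 thetaX /binprod.
  by rewrite big1 // => j _; rewrite mnm0E bin0.
rewrite IH big_cons; apply: boolp.funext => v.
rewrite /std cup_suml mulr_suml theta_sum; apply: eq_bigr => i _.
exact: cup_theta.
Qed.

End Std.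

(** In degree [k * d] the only monomial with no exponent larger than [d] is the
    one with all exponents equal to [d]. *)
Lemma sum_theta q : (forall m, m \in msupp q -> mdeg m = (k * d)%N) ->
  \sum_v theta q v = q@_[multinom d | _ < k].
Proof.
move=> hq; rewrite exchange_big /=.
rewrite (bigD1 [ffun=> ord_max]) //= -mulr_sumr sum_binprod_top => [|i]; last first.
  by rewrite mnmE ffunE.
rewrite mulr1 big1 ?addr0 => [|a an].
  by congr (q@_ _); apply/mnmP => i; rewrite !mnmE ffunE.
rewrite -mulr_sumr; case: (boolP (box a \in msupp q)) => [/hq|]; last first.
  by move/memN_msupp_eq0->; rewrite mul0r.
rewrite mdegE => e; case/eqP: an; apply/ffunP => i; rewrite ffunE; apply/val_inj => /=.
apply/eqP; rewrite eqn_leq -ltnS ltn_ord /= leqNgt; apply/negP => lt.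
suff : (\sum_i (box a) i < k * d)%N by rewrite e ltnn.
rewrite -[X in (_ < X * _)%N]card_ord -sum_nat_const.
rewrite (bigD1 i) //= [X in (_ < X)%N](bigD1 i) //= -addSn leq_add //.
  by rewrite mnmE.
by apply: leq_sum => j _; rewrite mnmE -ltnS.
Qed.

End Theta.

Lemma mpolyX_seq k (m : 'X_{1..k}) :
  exists e : seq 'I_k, 'X_[m] = \prod_(j <- e) 'X_j :> {mpoly 'F_2[k]}.
Proof.
exists (flatten [seq nseq (m i) i | i <- index_enum 'I_k]).
rewrite big_flatten big_map mpolyXE_id; apply: eq_bigr => i _.
by rewrite big_nseq iter_mulr_1.
Qed.

(** The ideal of the powers [t_i^(d+1)] is spanned by the monomials with some
    exponent larger than [d]. *)
Lemma notin_ideal k d (p : {mpoly 'F_2[k]}) :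
  ~ ideal_gen (fun i : 'I_k => PolyF2.t i ^+ d.+1) (p : PolyF2.A k) ->
  exists2 b, p@_b != 0 & forall i, (b i <= d)%N.
Proof.
move=> np; case: (boolP (has (fun b : 'X_{1..k} => [forall i, (b i <= d)%N]) (msupp p))).
  case/hasP => b; rewrite mcoeff_msupp => pb /forallP h; by exists b.
move=> nh; case: np; rewrite [p]mpolyE; apply: ideal_gen_sum => b bp _.
have /forallPn [i] : ~~ [forall i, (b i <= d)%N].
  by apply: contra nh => h; apply/hasP; exists b.
rewrite -ltnNge => lt; rewrite -mul_mpolyC.
have -> : b = (b - U_(i) *+ d.+1 + U_(i) *+ d.+1)%MM.
  rewrite submK //; apply/mnm_lepP => j; rewrite mulmnE mnm1E.
  by case: eqP => [<-|]; rewrite ?mul1n.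
rewrite mpolyXD mulrA; apply: (@ideal_genM (PolyF2.A k)).
by rewrite -mpolyXn; apply: (ideal_gen_gen _ i).
Qed.

Lemma prod_homog k (T : Type) (chi : T -> 'I_k -> bool) (r : seq T) :
  \prod_(a <- r) lform chi a \is (size r).-homog.
Proof.
elim: r => [|a r IH]; first by rewrite big_nil dhomog1.
rewrite big_cons -[size _]add1n dhomogM // /lform rpred_sum // => i _.
by rewrite dhomogX; apply/eqP; exact: mdeg1.
Qed.

(** If the product of the classes of the labellings is not zero, then all of
    them take two values near some vertex.  The bound [n] on the distances does
    not depend on the grid.  The list of labellings is completed by lexicographic
    signs, in order to reach the top degree [k * d] with a nonzero cup
    product. *)
Theorem tucker k d (T : eqType) (chi : T -> 'I_k -> bool) (r : seq T) :
  ~ ideal_gen (fun i : 'I_k => PolyF2.t i ^+ d.+1)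
      (\prod_(a <- r) \sum_(i | chi a i) PolyF2.t i) ->
  exists n, forall L (s : T -> vertex k d L -> 'F_2),
    (forall a, labelling (fun i => (chi a i)%:R) (s a)) ->
    exists v, forall a, a \in r -> exists w w',
      [/\ nearby n v w, nearby n v w' & s a w != s a w'].
Proof.
move/notin_ideal=> [b pb bd].
pose p : {mpoly 'F_2[k]} := \prod_(a <- r) lform chi a.
have [e Xe] := mpolyX_seq ([multinom d | _ < k] - b)%MM.
pose T' := (T + 'I_k)%type.
pose chi' (a : T') := match a with inl a => chi a | inr j => fun i => i == j end.
pose r' : seq T' := map inl r ++ map inr e.
exists (size r') => L s sl.
pose s' (a : T') : vertex k d L -> 'F_2 :=
  match a with inl a => s a | inr j => fun v => (lex_neg j v)%:R end.
have s'l a : labelling (fun i => (chi' a i)%:R) (s' a).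
  by case: a => [a|j] //=; apply: lex_neg_labelling; exact: pchar_F2.
have pE : \prod_(a <- r') lform chi' a = p * 'X_[[multinom d | _ < k] - b].
  rewrite big_cat !big_map Xe; congr (_ * _); apply: eq_bigr => i _.
  by rewrite /lform /= big_pred1_eq.
have db : (b <= [multinom d | _ < k])%MM by apply/mnm_lepP => i; rewrite mnmE.
have : \sum_v cups s' r' (fun=> 1) v != 0.
  rewrite (sum_cups_homotopy pchar_F2 (chi := fun a i => (chi' a i)%:R)
    (s' := std chi')) //; last exact: std_labelling.
  rewrite cups_std sum_theta.
    by rewrite pE -[X in _@_X](submK db) mcoeffMX.
  move=> m; rewrite mcoeff_msupp => mp.
  have := prod_homog chi' r'; move/dhomogP => /(_ m); rewrite mcoeff_msupp => /(_ mp) ->.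
  have /dhomogP /(_ b) := prod_homog chi r; rewrite mcoeff_msupp => /(_ pb) eb.
  have : mdeg ([multinom d | _ < k] - b) = size e.
    have := prod_homog (fun (j : 'I_k) i => i == j) e.
    rewrite (_ : \prod_(a <- e) _ = 'X_[[multinom d | _ < k] - b]).
      by rewrite dhomogX => /eqP.
    by rewrite Xe; apply: eq_bigr => i _; rewrite /lform big_pred1_eq.
  rewrite size_cat !size_map => <-; rewrite -eb -mdegD addmC submK //.
  rewrite mdegE (eq_bigr (fun=> d)) => [|i _]; last by rewrite mnmE.
  by rewrite sum_nat_const card_ord.
move=> nz; have [v vn] : exists v, cups s' r' (fun=> 1) v != 0.
  case: (pickP (fun v => cups s' r' (fun=> 1) v != 0)) => [v h|h]; first by exists v.
  by case/eqP: nz; rewrite big1 // => v _; apply/eqP; move/negbFE: (h v).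
exists v => a ar.
have ar' : inl a \in r' by rewrite mem_cat mem_map ?ar // => x y [].
exact: (cups_neq0 pchar_F2 vn ar').
Qed.

End Tucker.

(** * Complete symmetric polynomials modulo 2 *)

Section CompleteSymmetric.
Variable Q : comNzRingType.
Implicit Types (x y : Q) (s : seq Q) (r : nat).

(** Complete symmetric polynomials of the elements of [s], by recursion on [s]
    and then on the degree. *)
Fixpoint csym_rec s : nat -> Q :=
  match s with
  | [::] => fun r => (r == 0%N)%:R
  | x :: s' => fix hx r := if r is r'.+1 then csym_rec s' r + x * hx r' else 1
  end.

Fact csym_key : unit. Proof. by []. Qed.

(** Locked, because the recursion on the degree should only be unfolded by
    [csym_cons]. *)
Definition csym := locked_with csym_key csym_rec.

(** The product of all the [x + y], for [x] before [y] in [s]. *)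
Fixpoint vander s : Q :=
  if s is x :: s' then \prod_(y <- s') (x + y) * vander s' else 1.

Lemma csym0 s : csym s 0 = 1.
Proof. by rewrite [csym]unlock; case: s. Qed.

Lemma csym_cons x s r : csym (x :: s) r.+1 = csym s r.+1 + x * csym (x :: s) r.
Proof. by rewrite [csym]unlock. Qed.

Lemma csym_nil r : csym [::] r = (r == 0%N)%:R.
Proof. by rewrite [csym]unlock. Qed.

Lemma csym1 x r : csym [:: x] r = x ^+ r.
Proof.
elim: r => [|r IH]; first by rewrite expr0 csym0.
by rewrite csym_cons IH exprS csym_nil add0r.
Qed.

Lemma csym_swap x y s r : csym (x :: y :: s) r = csym (y :: x :: s) r.
Proof.
elim/ltn_ind: r => -[|r] IH; first by rewrite !csym0.
rewrite !csym_cons -!addrA; congr (_ + _).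
case: r IH => [|r] IH; first by rewrite !csym0 !mulr1 addrC.
rewrite -(IH r.+1) //.
have e1 := csym_cons x (y :: s) r.
have e2 : csym [:: x, y & s] r.+1 = csym (x :: s) r.+1 + y * csym [:: x, y & s] r.
  by rewrite (IH r.+1) // (IH r) // csym_cons.
by rewrite [in LHS]e2 [in RHS]e1; ring.
Qed.

Hypothesis addQQ : forall x : Q, x + x = 0.

(** Divided differences. *)
Lemma csym_diff x y s r :
  (x + y) * csym (x :: y :: s) r = csym (x :: s) r.+1 + csym (y :: s) r.+1.
Proof.
have e1 := csym_cons x (y :: s) r; have := csym_cons y (x :: s) r.
rewrite !(csym_swap y x) e1 mulrDl => e2.
have -> : x * csym [:: x, y & s] r =
    csym (y :: s) r.+1 + (csym (x :: s) r.+1 + y * csym [:: x, y & s] r).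
  by rewrite -e2 addrA addQQ add0r.
by rewrite -!addrA addQQ addr0 addrC.
Qed.

(** The bialternant formula makes [vander s * csym s r] an alternating sum of
    monomials, each divisible by some [x ^+ (r + size s - 1)]; the proof is by
    induction with [csym_diff]. *)
Lemma vander_csym_ideal n (g : 'I_n -> Q) s r : s != [::] ->
  (forall x, x \in s -> ideal_gen g (x ^+ (r + (size s).-1))) ->
  ideal_gen g (vander s * csym s r).
Proof.
move: {2}(size s) (leqnn (size s)) => c.
elim: c s r => [|c IH] [|x [|y s]] //= r le _ h.
  by rewrite big_nil !mul1r csym1 -[r]addn0; apply: h; rewrite inE.
have -> : vander [:: x, y & s] * csym [:: x, y & s] r =
    \prod_(z <- s) (y + z) * (vander (x :: s) * csym (x :: s) r.+1) +
    \prod_(z <- s) (x + z) * (vander (y :: s) * csym (y :: s) r.+1).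
  have := csym_diff x y s r.
  rewrite [vander [:: x, y & s]]/= [vander (x :: s)]/= [vander (y :: s)]/= big_cons.
  move: (csym _ _) (csym _ _) (csym _ _) (vander s) => a b c' V.
  move: (\prod_(z <- s) (y + z)) (\prod_(z <- s) (x + z)) => P1 P2 e.
  transitivity (P1 * P2 * V * ((x + y) * c')); first by ring.
  by rewrite e; ring.
apply: ideal_genD; apply: ideal_genM; apply: IH => //= z zs.
  rewrite addSnnS; apply: h; move: zs; rewrite !inE => /orP[->//|->].
  by rewrite !orbT.
by rewrite addSnnS; apply: h; rewrite inE zs orbT.
Qed.

(** The generating polynomial of the elementary symmetric polynomials. *)
Definition esym_gen s : {poly Q} := \prod_(x <- s) (1 + x *: 'X).

Lemma esym_gen_csym s l : \sum_(j < l.+1) (esym_gen s)`_j * csym s (l - j) = (l == 0%N)%:R.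
Proof.
elim: s l => [|x s IH] l.
  rewrite big_ord_recl /= big1 => [|i _].
    by rewrite /esym_gen big_nil coef1 mul1r addr0 subn0 csym_nil.
  by rewrite /esym_gen big_nil coef1 mul0r.
rewrite /esym_gen big_cons -/(esym_gen s).
have e j : ((1 + x *: 'X) * esym_gen s)`_j =
    (esym_gen s)`_j + x * (if j is j'.+1 then (esym_gen s)`_j' else 0).
  rewrite mulrDl mul1r coefD -scalerAl coefZ coefXM; by case: j.
under eq_bigr => j _ do rewrite e mulrDl.
rewrite big_split /= [X in _ + X]big_ord_recl /= mulr0 mul0r add0r.
rewrite big_ord_recr /= subnn !csym0 -[in RHS]IH big_ord_recr /= subnn !csym0.
rewrite addrAC; congr (_ + _); rewrite -big_split; apply: eq_bigr => j _ /=.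
rewrite /bump /= add1n.
have -> : (l - j = (l - j.+1).+1)%N by have := ltn_ord j; lia.
by rewrite csym_cons mulrDr -addrA -{1}(mulrCA x) -mulrA addQQ addr0.
Qed.

End CompleteSymmetric.

Module Flag.
Import mpoly.
#[local] Arguments PolyF2.wbar : simpl never.

Section Multinomial.
Variable k : nat.
Implicit Types a : 'X_{1..k}.

(** The denominator of the multinomial coefficient of [a]. *)
Definition mfact a := (\prod_(j < k) (a j)`!)%N.

Lemma mfact_gt0 a : (0 < mfact a)%N.
Proof. by rewrite prodn_gt0 // => j; apply: fact_gt0. Qed.

Lemma mdeg_pred a j : (0 < a j)%N -> mdeg a = (mdeg (a - U_(j))).+1.
Proof.
move=> aj; have le : (U_(j) <= a)%MM by rewrite lep1mP -lt0n.
by rewrite -{1}(submK le) mdegD; rewrite [mdeg U_(j)]mdeg1 addn1.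
Qed.

Lemma mfact_pred a j : (0 < a j)%N -> mfact a = (a j * mfact (a - U_(j))%MM)%N.
Proof.
move=> aj; rewrite /mfact (bigD1 j) //= [in RHS](bigD1 j) //= mulnA.
rewrite mnmBE mnm1E eqxx subn1 -[in LHS](prednK aj) factS prednK //.
congr (_ * _)%N; apply: eq_bigr => i ij.
by rewrite mnmBE mnm1E eq_sym (negPf ij) subn0.
Qed.

(** The division in [PolyF2.multinomial] is exact, and the multinomial
    coefficients satisfy the Pascal recurrence. *)
Lemma multinomialP a :
  (PolyF2.multinomial a * mfact a = (mdeg a)`!)%N /\
  (a != 0%MM -> PolyF2.multinomial a =
    \sum_(j < k | (0 < a j)%N) PolyF2.multinomial (a - U_(j))%MM)%N.
Proof.
move: {2}(mdeg a) (erefl (mdeg a)) => N; elim: N a => [|N IH] a e.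
  move/eqP: (e); rewrite mdeg_eq0 => /eqP ->; rewrite eqxx; split=> //.
  rewrite /PolyF2.multinomial /mfact mdeg0 [(\prod_(_ < _) _)%N]big1 ?divn1 ?muln1 //.
  by move=> i _; rewrite mnm0E.
have key : ((mdeg a)`! =
    (\sum_(j < k | 0 < a j) PolyF2.multinomial (a - U_(j))%MM) * mfact a)%N.
  rewrite e factS -{1}e mdegE big_distrl /= (bigID (fun j => 0 < a j)%N) /=.
  rewrite [X in (_ + X)%N]big1 ?addn0; last by move=> j; rewrite -eqn0Ngt => /eqP->.
  rewrite big_distrl; apply: eq_bigr => j aj.
  have ej : mdeg (a - U_(j)) = N by move: e; rewrite (mdeg_pred aj) => -[].
  have [i1 _] := IH _ ej; rewrite ej in i1; rewrite -i1.
  by rewrite (mfact_pred aj) mulnCA.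
have q : PolyF2.multinomial a =
    (\sum_(j < k | (0 < a j)%N) PolyF2.multinomial (a - U_(j))%MM)%N.
  by rewrite [LHS]/PolyF2.multinomial key mulnK // mfact_gt0.
by split=> //; rewrite q key.
Qed.

End Multinomial.

Section Wbar.
Variable k : nat.
Local Notation A := {mpoly 'F_2[k]}.

Lemma addAA (p : A) : p + p = 0.
Proof.
rewrite -mulr2n -mulr_natl -mpolyC_nat.
by rewrite (_ : 2%:R = 0) ?mpolyC0 ?mul0r //; apply/val_inj.
Qed.

(** The monomial of exponent [a] in the elementary symmetric polynomials. *)
Definition wmon (a : 'X_{1..k}) : A := \prod_(j < k) (mesym k 'F_2 j.+1) ^+ a j.

Definition wterm (a : 'X_{1..k}) : A :=
  (PolyF2.multinomial a)%:R * wmon a.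

Lemma wbarE l : PolyF2.wbar k (Posz l) =
  \sum_(a : 'X_{1..k < l.+1} | mnmwgt a == l) wterm a.
Proof. by []. Qed.

Lemma wmon_pred (a : 'X_{1..k}) j : (0 < a j)%N ->
  wmon a = mesym k 'F_2 j.+1 * wmon (a - U_(j))%MM.
Proof.
move=> aj; rewrite /wmon (bigD1 j) //= [in RHS](bigD1 j) //= mulrA.
rewrite mnmBE mnm1E eqxx subn1 -exprS prednK //.
congr (_ * _); apply: eq_bigr => i ij.
by rewrite mnmBE mnm1E eq_sym (negPf ij) subn0.
Qed.

Lemma wterm_rec a : a != 0%MM ->
  wterm a = \sum_(j < k | (0 < a j)%N) mesym k 'F_2 j.+1 * wterm (a - U_(j))%MM.
Proof.
move=> a0; have [_ /(_ a0) e] := multinomialP a.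
rewrite /wterm e natr_sum mulr_suml; apply: eq_bigr => j aj.
by rewrite (wmon_pred aj) mulrCA.
Qed.

(** Shifting the exponents by [U_(j)] increases the weight by [j.+1]. *)
Lemma wgt_shift (f : 'X_{1..k} -> A) l (j : 'I_k) :
  \sum_(a : 'X_{1..k < (j.+1 + l).+1} | (mnmwgt a == j.+1 + l)%N && (0 < (a : 'X_{1..k}) j)%N)
     f (a - U_(j))%MM =
  \sum_(a : 'X_{1..k < l.+1} | mnmwgt a == l) f a.
Proof.
pose h (a : 'X_{1..k < l.+1}) : 'X_{1..k < (j.+1 + l).+1} := insubd (@bm0 k _) (a + U_(j))%MM.
pose h' (a : 'X_{1..k < (j.+1 + l).+1}) : 'X_{1..k < l.+1} := insubd (@bm0 k _) (a - U_(j))%MM.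
have hE a : h a = (a + U_(j))%MM :> 'X_{1..k}.
  rewrite /h insubdK // unfold_in mdegD [mdeg U_(j)]mdeg1.
  by have := bmdeg a; lia.
rewrite (reindex_onto h h') => [|a /andP[/eqP wa aj]]; last first.
  have le : (U_(j) <= a)%MM by rewrite lep1mP -lt0n.
  have ew : mnmwgt (a - U_(j))%MM = l.
    by move: wa; rewrite -{1}(submK le) mnmwgtD mnmwgt1; lia.
  apply: val_inj; rewrite [LHS]hE /h' insubdK ?submK // unfold_in ltnS -{2}ew.
  exact: leq_mdeg_mnmwgt.
apply: eq_big => a; last by rewrite hE addmK.
rewrite hE mnmwgtD mnmwgt1 mnmDE mnm1E eqxx addn1 andbT addnC eqn_add2l.
rewrite (_ : h' (h a) = a) ?eqxx ?andbT //.
by apply: val_inj; rewrite /h' hE addmK /= insubdK // unfold_in bmdeg.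
Qed.

Lemma wbar_rec l : (0 < l)%N -> PolyF2.wbar k (Posz l) =
  \sum_(j < k | (j < l)%N) mesym k 'F_2 j.+1 * PolyF2.wbar k (Posz (l - j.+1)).
Proof.
move=> l0; rewrite wbarE.
have aw0 (a : 'X_{1..k < l.+1}) : mnmwgt a == l -> a != 0%MM :> 'X_{1..k}.
  by move=> /eqP e; apply/eqP => a0; move: e; rewrite a0 mnmwgt0; lia.
rewrite (eq_bigr _ (fun a wa => wterm_rec (aw0 a wa))).
rewrite (exchange_big_dep (fun j : 'I_k => j < l)%N) /=; last first.
  move=> a j /eqP wa aj; suff : (j < mnmwgt a)%N by rewrite wa.
  rewrite /mnmwgt (bigD1 j) //=.
  by apply: leq_trans (leq_addr _ _); rewrite leq_pmull.
apply: eq_bigr => j lt; rewrite -mulr_sumr; congr (_ * _).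
rewrite wbarE; move: (l - j.+1)%N (subnKC lt) => l' e.
by rewrite -{l l0 aw0 lt}e wgt_shift.
Qed.

(** The sequence of the variables. *)
Definition vars : seq A := [seq 'X_i | i <- enum 'I_k].

Lemma esym_gen_vars j : (esym_gen vars)`_j = mesym k 'F_2 j.
Proof.
rewrite /esym_gen big_map big_enum /=.
under eq_bigr => i _ do rewrite addrC.
rewrite bigA_distr coef_sum mesymE (bigID (fun J : {set 'I_k} => #|J| == j)) /=.
rewrite [X in _ + X]big1 ?addr0 => [|J nJ]; last first.
  rewrite (bigID (fun i => i \in J)) /= [X in _ * X]big1 ?mulr1; last by move=> i /negPf->.
  rewrite (eq_bigr (fun i => ('X_i)%:P * 'X)) => [|i ->]; last by rewrite mul_polyC.
  rewrite big_split /= -rmorph_prod prodr_const mul_polyC coefZ coefXn eq_sym.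
  by rewrite (negPf nJ) mulr0.
apply: eq_bigr => J /eqP eJ.
rewrite (bigID (fun i => i \in J)) /= [X in _ * X]big1 ?mulr1; last by move=> i /negPf->.
rewrite (eq_bigr (fun i => ('X_i)%:P * 'X)) => [|i ->]; last by rewrite mul_polyC.
rewrite big_split /= -rmorph_prod prodr_const mul_polyC coefZ coefXn eq_sym eJ eqxx mulr1.
rewrite mpolyXE_id [RHS](bigID (fun i => i \in J)) /= [X in _ = _ * X]big1 ?mulr1.
  by apply: eq_bigr => i iJ; rewrite mnmE iJ expr1.
by move=> i iJ; rewrite mnmE (negPf iJ).
Qed.

(** Both sides satisfy the recurrence [wbar_rec]. *)
Lemma wbar_csym l : PolyF2.wbar k (Posz l) = csym vars l.
Proof.
elim/ltn_ind: l => -[|l] IH; first by rewrite csym0; apply: PolyF2.wbar0.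
have := esym_gen_csym addAA vars l.+1; rewrite big_ord_recl subn0.
rewrite esym_gen_vars mesym0E mul1r => /eqP; rewrite addr_eq0 => /eqP ->.
rewrite wbar_rec // -sumrN.
have sN (p : A) : - p = p by apply/eqP; rewrite eq_sym -addr_eq0 addAA.
under [RHS]eq_bigr => j _ do rewrite sN esym_gen_vars.
transitivity (\sum_(0 <= j < l.+1 | (j < k)%N) mesym k 'F_2 j.+1 * csym vars (l.+1 - j.+1)).
  rewrite (eq_bigr (fun j : 'I_k => mesym k 'F_2 j.+1 * csym vars (l.+1 - j.+1))) => [|j jl].
    rewrite -(big_mkord (fun j => (j < l.+1)%N)
      (fun j => mesym k 'F_2 j.+1 * csym vars (l.+1 - j.+1))).
    have [lk|kl] := leqP k l.+1.
      rewrite big_nat_cond [RHS](big_cat_nat _ (n := k)) //=.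
      rewrite [X in _ + X]big1_seq ?addr0; last first.
        by move=> j /andP[jk]; rewrite mem_index_iota leqNgt jk.
      rewrite [RHS]big_nat_cond; apply: eq_bigl => j; lia.
    rewrite (big_cat_nat _ (n := l.+1)) //=; last exact: ltnW.
    rewrite [X in _ + X]big1_seq ?addr0; last first.
      by move=> j /andP[jk]; rewrite mem_index_iota leqNgt jk.
    rewrite [LHS]big_nat_cond [RHS]big_nat_cond; apply: eq_bigl => j; lia.
  by rewrite IH //; lia.
rewrite big_mkord big_mkcond; apply: eq_bigr => j _ /=.
rewrite /bump add1n; case: ltnP => // kj.
rewrite mesym_geqnE ?mul0r //.
Qed.

End Wbar.

(** * The colon ideal of the Vandermonde product *)

Section Reduction.
Variable k n : nat.
Local Notation A := {mpoly 'F_2[k]}.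
Local Notation vars := (vars k).
Let J := ideal_gen (PolyF2.wbar_gens n (k := k)).
Let I := ideal_gen (fun i : 'I_k => PolyF2.t i ^+ n).

Lemma size_vars : size vars = k.
Proof. by rewrite size_map size_enum_ord. Qed.

Lemma drop_vars (i : 'I_k) : drop i vars = 'X_i :: drop i.+1 vars.
Proof.
rewrite (drop_nth 0) ?size_vars //.
by rewrite (nth_map i) ?size_enum_ord // nth_ord_enum.
Qed.

(** By [csym_cons], each step from [drop i vars] to [drop i.+1 vars] raises the
    smallest admissible degree by one. *)
Lemma csym_drop_ideal (i : nat) r : (i < k)%N -> (n.+1 + i <= r + k)%N -> (r <= n)%N ->
  J (csym (drop i vars) r).
Proof.
elim: i r => [|i IH] r ik rk rn.
  rewrite drop0 -wbar_csym.
  have lt : (r + k - n.+1 < k)%N by lia.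
  have -> : Posz r = (n%:Z - k%:Z + 1 + (Ordinal lt)%:Z) by rewrite /=; lia.
  exact: (ideal_gen_gen (PolyF2.wbar_gens n (k := k)) (Ordinal lt)).
have ik' : (i < k)%N by apply: ltnW.
case: r rk rn => [|r] rk rn; first by rewrite csym0 -(csym0 (drop i vars)); apply: IH; lia.
have e := drop_vars (Ordinal ik'); rewrite /= in e.
have := csym_cons 'X_(Ordinal ik') (drop i.+1 vars) r; rewrite -e => eh.
have -> : csym (drop i.+1 vars) r.+1 =
    csym (drop i vars) r.+1 - 'X_(Ordinal ik') * csym (drop i vars) r.
  by rewrite eh addrK.
apply: (@ideal_genD (PolyF2.A k)); first by apply: IH => //; lia.
apply: (@ideal_genN (PolyF2.A k)); apply: (@ideal_genM (PolyF2.A k)); apply: IH => //; lia.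
Qed.

Lemma mnm1_lt (i j : 'I_k) : (i < j)%N -> (U_(j)%MM < U_(i)%MM)%O.
Proof.
move=> ij; apply/ltmcP; first by rewrite ![mdeg U_(_)]mdeg1.
exists i => [l li|]; rewrite !mnm1E ?eqxx -?val_eqE /=.
  by rewrite !gtn_eqF //; apply: ltn_trans ij.
by rewrite gtn_eqF.
Qed.

Lemma mnm1Mn_lt (i j : 'I_k) r : (i < j)%N -> ((U_(j) *+ r.+1)%MM < (U_(i) *+ r.+1)%MM)%O.
Proof.
move=> ij; elim: r => [|r IH]; first exact: mnm1_lt.
by rewrite mulmS [(_ *+ r.+2)%MM]mulmS ltm_add // mnm1_lt.
Qed.

Lemma csym_drop_lead (i : nat) (ik : (i < k)%N) r :
  mlead (csym (drop i vars) r) = (U_(Ordinal ik) *+ r)%MM /\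
  (csym (drop i vars) r)@_(U_(Ordinal ik) *+ r) = 1.
Proof.
move: {2}(k - i)%N (leqnn (k - i)) => c; elim: c i ik r => [|c IH] i ik r le; first by lia.
have e := drop_vars (Ordinal ik); rewrite /= in e.
elim: r => [|r [IH1 IH2]]; first by rewrite csym0 mulm0n mlead1 mcoeff1 eqxx.
have hc : csym (drop i vars) r.+1 =
    csym (drop i.+1 vars) r.+1 + 'X_(Ordinal ik) * csym (drop i vars) r.
  by rewrite {1 2}e csym_cons.
have nz : csym (drop i vars) r != 0.
  by apply/eqP => h0; move: IH2; rewrite h0 mcoeff0 => /eqP; rewrite eq_sym oner_eq0.
have l1 : mlead ('X_(Ordinal ik) * csym (drop i vars) r) = (U_(Ordinal ik) *+ r.+1)%MM.
  by rewrite mleadM ?IH1 ?mleadXm ?mulmS // -msize_poly_eq0 msizeX.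
have c1 : ('X_(Ordinal ik) * csym (drop i vars) r)@_(U_(Ordinal ik) *+ r.+1) = 1.
  by rewrite mulrC mulmS mcoeffMX IH2.
have lt : (mlead (csym (drop i.+1 vars) r.+1) < (U_(Ordinal ik) *+ r.+1)%MM)%O.
  have [ik1|ki] := ltnP i.+1 k.
    have [-> _] := IH i.+1 ik1 r.+1 ltac:(lia).
    exact: mnm1Mn_lt.
  rewrite drop_oversize ?size_vars // csym_nil mlead0.
  by apply: lt_mdeg_ltmc; rewrite mdeg0 mdegMn [mdeg U_(_)]mdeg1; lia.
by rewrite hc mleadDr l1 // mcoeffD c1 (mcoeff_gt_mlead lt) add0r.
Qed.

(** The exponent of the variable of index [i] is smaller than
    [n - (k - 1 - i)]. *)
Definition reduced (p : A) :=
  forall m, m \in msupp p -> forall i : 'I_k, (m i + (k - i.+1) < n)%N.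

(** Leading monomials that are not reduced are cancelled with the
    [csym (drop i vars) r], by induction on the monomial order. *)
Lemma reduction (p : A) : exists2 p', J (p - p') & reduced p'.
Proof.
suff H m : forall p : A, p != 0 -> mlead p = m -> exists2 p', J (p - p') & reduced p'.
  have [->|p0] := eqVneq p 0; last exact: (H _ _ p0 erefl).
  exists 0; first by rewrite subrr; apply: ideal_gen0.
  by move=> m; rewrite msupp0.
elim/(@ltmwf k): m => m IH {}p p0 pm.
have step (q : A) : mlead q = m -> q@_m = p@_m ->
    exists2 p', J (p - q - p') & reduced p'.
  move=> qm qc; have [e|d0] := eqVneq (p - q) 0.
    exists 0; first by rewrite e subrr; apply: ideal_gen0.
    by move=> m'; rewrite msupp0.
  apply: (IH _ _ _ d0 erefl).
  rewrite lt_neqAle; apply/andP; split.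
    apply/eqP => e; move: d0; rewrite -mleadc_eq0 e mcoeffB qc subrr eqxx //.
  by apply: le_trans (mleadB_le _ _) _; rewrite pm qm joinxx.
have cm : p@_m != 0 by rewrite -pm mleadc_eq0.
case: (boolP [forall i : 'I_k, (m i + (k - i.+1) < n)%N]) => [/forallP red|].
  have [||p' Jp' rp'] := step (p@_m *: 'X_[m]).
  - by rewrite mleadZ_proper ?mleadXm // mcoeffX eqxx mulr1.
  - by rewrite mcoeffZ mcoeffX eqxx mulr1.
  exists (p@_m *: 'X_[m] + p'); first by rewrite opprD addrA.
  move=> m' /msuppD_le; rewrite mem_cat => /orP[|/rp' //].
  by rewrite msuppMCX // inE => /eqP->.
rewrite negb_forall => /existsP[i]; rewrite -leqNgt => big.
pose r := (n.+1 + i - k)%N; have ltik := ltn_ord i.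
have [lh ch] := csym_drop_lead ltik r.
have ei : Ordinal ltik = i by apply: val_inj.
rewrite ei in lh ch.
have le : (U_(i) *+ r <= m)%MM.
  apply/mnm_lepP => j; rewrite mulmnE mnm1E; case: eqP => [<-|_] //.
  by rewrite mul1n /r; lia.
pose q : A := (p@_m *: 'X_[m - U_(i) *+ r]) * csym (drop i vars) r.
have hnz : csym (drop i vars) r != 0.
  by apply/eqP => h0; move: ch; rewrite h0 mcoeff0 => /eqP; rewrite eq_sym oner_eq0.
have Xnz : p@_m *: 'X_[m - U_(i) *+ r] != 0 :> A.
  by rewrite -msupp_eq0 msuppMCX.
have [||p' Jp' rp'] := step q.
- rewrite mleadM // lh mleadZ_proper ?mleadXm ?submK //.
  by rewrite mcoeffX eqxx mulr1.
- have e : (csym (drop i vars) r * 'X_[m - U_(i) *+ r])@_(m - U_(i) *+ r + U_(i) *+ r) = 1.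
    by rewrite mcoeffMX.
  by rewrite submK // in e; rewrite /q -scalerAl mcoeffZ [_ * csym _ _]mulrC e mulr1.
exists p' => //; rewrite (_ : p - p' = q + (p - q - p')); last by ring.
apply: (@ideal_genD (PolyF2.A k)) => //; apply: (@ideal_genM (PolyF2.A k)).
by apply: csym_drop_ideal; rewrite // /r; lia.
Qed.

Lemma ideal_supp (p : A) m : I p -> p@_m != 0 -> exists i, (n <= m i)%N.
Proof.
case=> q ->; rewrite (raddf_sum (mcoeff m)) /= => nz.
case: (boolP [exists i : 'I_k, (n <= m i)%N]) => [/existsP //|/existsPn no].
case/eqP: nz; apply: big1 => i _; apply/eqP; rewrite mcoeff_eq0.
rewrite /PolyF2.t mpolyXn (perm_mem (msuppMX _ _)); apply/mapP => -[m' _ e].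
by move: (no i); rewrite e mnmDE mulmnE mnm1E eqxx mul1n leq_addr.
Qed.

(** The Vandermonde product. *)
Definition Delta : A := \prod_(i < k) \prod_(j < k | (i < j)%N) ('X_i + 'X_j).

Lemma lead_XD (i j : 'I_k) : (i < j)%N -> mlead ('X_i + 'X_j : A) = U_(i)%MM.
Proof. by move=> ij; rewrite mleadDl ?mleadXm // mnm1_lt. Qed.

Lemma XD_neq0 (i j : 'I_k) : (i < j)%N -> 'X_i + 'X_j != 0 :> A.
Proof.
move=> ij; apply/eqP => e; have := lead_XD ij; rewrite e mlead0 => /esym/eqP.
by rewrite mnm1_eq0.
Qed.

Lemma Delta_neq0 : Delta != 0.
Proof.
by apply/prodf_neq0 => i _; apply/prodf_neq0 => j ij; apply: XD_neq0.
Qed.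

Lemma lead_Delta i : (mlead Delta) i = (k - i.+1)%N.
Proof.
rewrite /Delta mlead_prod; last by move=> i' _ _; apply/prodf_neq0 => j; apply: XD_neq0.
rewrite mnm_sumE (bigD1 i) //= [X in (_ + X)%N]big1 ?addn0 => [|i' ni].
  rewrite mlead_prod => [|j _ ij]; last exact: XD_neq0.
  rewrite (eq_bigr (fun=> U_(i)%MM)) => [|j ij]; last exact: lead_XD.
  rewrite mnm_sumE (eq_bigr (fun=> 1%N)) => [|j _]; last by rewrite mnm1E eqxx.
  rewrite -(big_mkord (fun j => i < j)%N (fun=> 1%N)).
  rewrite (big_cat_nat _ (n := i.+1)) //= big1_seq ?add0n; last first.
    by move=> j /andP[ij]; rewrite mem_index_iota; lia.
  rewrite big_nat_cond (eq_bigl (fun j => i.+1 <= j < k)%N) => [|j].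
    by rewrite -big_nat sum_nat_const_nat muln1.
  by lia.
rewrite mlead_prod => [|j _ ij]; last exact: XD_neq0.
rewrite (eq_bigr (fun=> U_(i')%MM)) => [|j ij]; last exact: lead_XD.
by rewrite mnm_sumE big1 // => j _; rewrite mnm1E (negPf ni).
Qed.

Lemma vander_sorted (s : seq 'I_k) : sorted (fun i j : 'I_k => i < j)%N s ->
  vander [seq 'X_i | i <- s] = \prod_(i <- s) \prod_(j <- s | (i < j)%N) ('X_i + 'X_j) :> A.
Proof.
elim: s => [|i s IH] /=; first by rewrite big_nil.
rewrite path_sortedE; last by move=> a b c; apply: ltn_trans.
move=> /andP[/allP lt so]; rewrite IH // big_cons big_cons ltnn big_map; congr (_ * _).
  by rewrite big_seq [RHS]big_seq_cond; apply: eq_bigl => j; apply/esym/andb_idr/lt.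
rewrite big_seq [RHS]big_seq; apply: eq_bigr => j js.
by rewrite big_cons ltnNge ltnW ?lt.
Qed.

Lemma vander_vars : vander vars = Delta.
Proof.
rewrite vander_sorted; last first.
  by have := iota_ltn_sorted 0 k; rewrite -val_enum_ord sorted_map.
by rewrite big_enum; apply: eq_bigr => i _; rewrite big_enum_cond.
Qed.

Lemma Delta_wbar_ideal p : J p -> I (Delta * p).
Proof.
case=> q ->; rewrite mulr_sumr; apply: (@ideal_gen_sum (PolyF2.A k)) => i _ _.
rewrite mulrCA; apply: (@ideal_genM (PolyF2.A k)); rewrite /PolyF2.wbar_gens.
case e : (_ + _) => [l|l]; last by rewrite mulr0; apply: ideal_gen0.
rewrite wbar_csym -vander_vars; apply: (vander_csym_ideal (@addAA k)) => [|x].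
  by rewrite -size_eq0 size_vars -lt0n; have := ltn_ord i; lia.
move=> /mapP[j _ ->]; rewrite size_vars.
have -> : (l + k.-1 = (l + k.-1 - n) + n)%N by have := ltn_ord i; lia.
rewrite exprD; apply: (@ideal_genM (PolyF2.A k)).
exact: (ideal_gen_gen (fun i : 'I_k => PolyF2.t i ^+ n) j).
Qed.

Lemma Delta_colon p : I (Delta * p) -> J p.
Proof.
move=> Ip; have [p' Jp' rp'] := reduction p.
have [p0|p0] := eqVneq p' 0; first by move: Jp'; rewrite p0 subr0.
have Ip' : I (Delta * p').
  have -> : Delta * p' = Delta * p + - (Delta * (p - p')) by ring.
  apply: (@ideal_genD (PolyF2.A k)) => //; apply: (@ideal_genN (PolyF2.A k)).
  exact: Delta_wbar_ideal.
have nz : Delta * p' != 0 by rewrite mulf_neq0 // Delta_neq0.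
have [i] : exists i, (n <= (mlead (Delta * p')) i)%N.
  by apply: (ideal_supp Ip'); rewrite mleadc_eq0.
rewrite mleadM ?Delta_neq0 // mnmDE lead_Delta addnC leqNgt.
by rewrite rp' // mlead_supp.
Qed.

End Reduction.
End Flag.

(** The ideal of the [wbar] contains the colon ideal of [<t_i^n>] by the
    Vandermonde product. *)
Lemma vandermonde_colon (k n : nat) (p : PolyF2.A k) :
  ideal_gen (fun i : 'I_k => PolyF2.t i ^+ n)
    (\prod_(i < k) \prod_(j < k | (i < j)%N) (PolyF2.t i + PolyF2.t j) * p) ->
  ideal_gen (PolyF2.wbar_gens n (k := k)) p.
Proof. exact: Flag.Delta_colon. Qed.

From mathcomp Require Import lra.
From mathcomp Require Import all_classical all_reals all_analysis.

Import Num.Theory.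
Import numFieldNormedType.Exports.
Local Open Scope classical_set_scope.
Local Open Scope ring_scope.

(** * A Borsuk-Ulam theorem for products of cubes *)

Section Cubes.
Variables (R : realType) (k d : nat).

Definition cube_dim := #|{: 'I_k * 'I_d}|.

(** Points of the product of [k] cubes of dimension [d] are vectors of size
    [k * d]; [entry x i c] is the [c]-th coordinate of the [i]-th component. *)
Definition entry (x : 'rV[R]_cube_dim) (i : 'I_k) (c : 'I_d) : R := x ord0 (enum_rank (i, c)).

(** [x] lies on the boundary of the [i]-th cube, and [y] is obtained from [x] by
    changing the sign of the [i]-th component. *)
Definition antipodal_at (i : 'I_k) (x y : 'rV[R]_cube_dim) : Prop :=
  [/\ exists c, `|entry x i c| = 1, forall c, entry y i c = - entry x i c
    & forall j c, j != i -> entry y j c = entry x j c].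

Definition grid_point L (v : vertex k d L) : 'rV[R]_cube_dim :=
  \row_q ((v (enum_val q))%:R / (centre L)%:R - 1).

Lemma entry_grid_point L (v : vertex k d L) i c :
  entry (grid_point v) i c = (v (i, c))%:R / (centre L)%:R - 1.
Proof. by rewrite /entry mxE enum_rankK. Qed.

Lemma centre_gt0 L : 0 < (centre L)%:R :> R.
Proof. by rewrite ltr0n /centre. Qed.

Lemma grid_point_neg L (v : vertex k d L) i :
  on_boundary i v -> antipodal_at i (grid_point v) (grid_point (neg i v)).
Proof.
have c0 := centre_gt0 L.
have e4 : (4 * L.+1)%:R = 2 * (centre L)%:R :> R by rewrite -natrM /centre mulnA.
move=> /existsP[c bc]; split.
- exists c; rewrite entry_grid_point; case/orP: bc => /eqP ->.
    by rewrite mul0r sub0r normrN1.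
  by rewrite e4 mulfK ?gt_eqF // (_ : 2 - 1 = 1) ?normr1 //; ring.
- move=> c'; rewrite !entry_grid_point ffunE eqxx /=.
  set u := v (i, c'); have le : (u <= 4 * L.+1)%N by rewrite -ltnS ltn_ord.
  rewrite subSS natrB // e4 mulrBl mulfK ?gt_eqF //; ring.
by move=> j c' ji; rewrite !entry_grid_point ffunE /= (negPf ji).
Qed.

Lemma grid_point_cube L (v : vertex k d L) q : grid_point v ord0 q \in `[-1, 1].
Proof.
have c0 := centre_gt0 L; rewrite mxE in_itv /=.
set u := v _; have le : (u <= 4 * L.+1)%N by rewrite -ltnS ltn_ord.
have e4 : (4 * L.+1)%:R = 2 * (centre L)%:R :> R by rewrite -natrM /centre mulnA.
have le' : u%:R <= 2 * (centre L)%:R :> R by rewrite -e4 ler_nat.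
apply/andP; split.
  by rewrite lerBrDl subrr divr_ge0 // ltW.
by rewrite lerBlDr ler_pdivrMr.
Qed.

Lemma grid_point_nearby L n (v w : vertex k d L) q : nearby n v w ->
  `|grid_point v ord0 q - grid_point w ord0 q| <= n%:R / (centre L)%:R.
Proof.
have c0 := centre_gt0 L.
move=> /(_ (enum_val q)); rewrite !mxE => -[h1 h2].
set a := v _; set b := w _; rewrite -/a -/b in h1 h2.
have -> : a%:R / (centre L)%:R - 1 - (b%:R / (centre L)%:R - 1) =
    (a%:R - b%:R) / (centre L)%:R :> R.
  by ring.
have h0 : 0 <= (centre L)%:R^-1 :> R by rewrite invr_ge0 ltW.
rewrite normrM [X in _ * X]ger0_norm //; apply: ler_wpM2r => //.
rewrite ler_norml; apply/andP; split.
  by rewrite lerBrDl lerBlDr -natrD ler_nat.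
by rewrite lerBlDr addrC -natrD ler_nat.
Qed.

(** A Borsuk-Ulam theorem: in each grid the Tucker lemma gives a point close to
    sign changes of all the functions, and a cluster point of these points for
    finer and finer grids is a common zero. *)
Theorem borsuk_ulam_cubes (T : eqType) (chi : T -> 'I_k -> bool) (r : seq T)
    (g : T -> 'rV[R]_cube_dim -> R) :
  (forall a, continuous (g a)) ->
  (forall a i x y, antipodal_at i x y -> g a y = (-1) ^+ chi a i * g a x) ->
  ~ ideal_gen (fun i : 'I_k => PolyF2.t i ^+ d.+1)
      (\prod_(a <- r) \sum_(i | chi a i) PolyF2.t i) ->
  exists x, forall a, a \in r -> g a x = 0.
Proof.
move=> gc ganti /Tucker.tucker[n tk].
(* The sign of [g a]; at the zeros of [g a], any labelling with the right
   character will do. *)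
pose s L a (v : vertex k d L) : 'F_2 :=
  if g a (grid_point v) == 0 then Tucker.std chi a v else (g a (grid_point v) < 0)%R%:R.
have sl L a : labelling (fun i => (chi a i)%:R) (s L a).
  move=> i v b; rewrite /s (ganti _ _ _ _ (grid_point_neg b)) mulf_eq0 signr_eq0 /=.
  have [_|gn] := eqVneq (g a (grid_point v)) 0; first exact: Tucker.std_labelling.
  case: (chi a i); last by rewrite expr0 mul1r addr0.
  rewrite expr1 mulN1r oppr_lt0; move: gn; rewrite neq_lt => /orP[] h.
    by rewrite h ltNge ltW //= (addrr_pchar2 pchar_F2).
  by rewrite h ltNge ltW //= add0r.
have /choice[x_ x_P] : forall L, exists y : 'rV[R]_cube_dim,
    exists2 v : vertex k d L, y = grid_point v &
    forall a, a \in r ->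
    exists w w', [/\ nearby n v w, nearby n v w' & s L a w != s L a w'].
  by move=> L; have [v vP] := tk L _ (sl L); exists (grid_point v), v.
have [x [_ xcl]] : [set y : 'rV[R]_cube_dim | forall q, `[-1, 1]%classic (y ord0 q)] `&`
    cluster (x_ @ \oo) !=set0.
  apply: (@rV_compact R cube_dim (fun=> `[-1, 1]%classic)).
    by move=> _; apply: segment_compact.
  exists 0%N => // L _ q /=; have [v -> _] := x_P L.
  by have := grid_point_cube v q; rewrite in_itv.
exists x => a ar; apply/eqP/negPn/negP => gx.
have gcc : (g a y * g a x) @[y --> x] --> g a x * g a x.
  exact: (cvgM (gc a x) (@cvg_cst _ (g a x) _ (nbhs x) _)).
have gx2 : 0 < g a x * g a x by rewrite -expr2 exprn_even_gt0.
have : nbhs x [set y | 0 < g a y * g a x] by exact: (cvgr_gt _ gcc 0 gx2).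
move=> /nbhs_ballP[e /= e0 eU].
pose A := x_ @` [set L | n%:R / (centre L)%:R < e / 2].
have [||y [[L /= nL <-] [_ yx]]] := xcl A (ball x (e / 2)).
- exists (Num.bound (n%:R / (e / 2))) => // L /= leL; exists L => //=.
  have c0 := centre_gt0 L; have e2 : 0 < e / 2 by rewrite divr_gt0.
  rewrite ltr_pdivrMr // mulrC -ltr_pdivrMr //.
  apply: lt_le_trans (archi_boundP _) _; first by rewrite divr_ge0 // ltW.
  by rewrite ler_nat (leq_trans leL) // /centre; lia.
- by apply: nbhsx_ballx; rewrite divr_gt0.
have [v xv vP] := x_P L; rewrite xv in yx.
have [w [w' [vw vw' /eqP[]]]] := vP a ar.
have near_pos (u : vertex k d L) : nearby n v u -> 0 < g a (grid_point u) * g a x.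
  move=> vu; apply: eU; split=> // i q; rewrite ord1 -ball_normE /=.
  have := yx i q; rewrite ord1 -ball_normE /= => yxq.
  have := grid_point_nearby q vu => vq.
  have -> : x ord0 q - grid_point u ord0 q =
      (x ord0 q - grid_point v ord0 q) + (grid_point v ord0 q - grid_point u ord0 q).
    by ring.
  apply: le_lt_trans (ler_normD _ _) _; rewrite [e]splitr.
  by apply: ltrD => //; apply: le_lt_trans vq nL.
have := near_pos _ vw; have := near_pos _ vw'; rewrite /s.
move: (g a x) (g a (grid_point w)) (g a (grid_point w')) => c b b'.
have [->|] := eqVneq b 0; first by rewrite mul0r ltxx.
have [->|] := eqVneq b' 0; first by rewrite mul0r ltxx.
move=> _ _ h1 h2; congr (nat_of_bool _)%:R; apply/idP/idP => ?; nra.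
Qed.

End Cubes.

(** * From cubes to spheres *)

Section Continuity.
Variable R : realType.

Lemma cvg_mx (T : Type) (F : set_system T) (FF : Filter F) m n
    (f : T -> 'M[R]_(m, n)) (l : 'M[R]_(m, n)) :
  (forall i j, f t i j @[t --> F] --> l i j) -> f @ F --> l.
Proof.
move=> h A [P hP sPA]; rewrite /nbhs /=.
have : F [set t | forall i, forall j, P i j (f t i j)].
  by apply: filter_forall => i; apply: filter_forall => j; apply: h; apply: hP.
by apply: filterS => t ht; apply: sPA.
Qed.

Lemma continuous_prod (T : topologicalType) (I : Type) (r : seq I) (f : I -> T -> R) :
  (forall i, continuous (f i)) -> continuous (fun x => \prod_(i <- r) f i x).
Proof.
move=> fc x; elim: r => [|i r IH].
  rewrite (_ : (fun _ => _) = fun=> 1); first exact: cvg_cst.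
  by apply/funext => y; rewrite big_nil.
rewrite (_ : (fun _ => _) = fun y => f i y * \prod_(j <- r) f j y); last first.
  by apply/funext => y; rewrite big_cons.
exact: (cvgM (fc i x) IH).
Qed.

Lemma continuous_sum (T : topologicalType) (I : Type) (r : seq I) (f : I -> T -> R) :
  (forall i, continuous (f i)) -> continuous (fun x => \sum_(i <- r) f i x).
Proof.
move=> fc x; elim: r => [|i r IH].
  rewrite (_ : (fun _ => _) = fun=> 0); first exact: cvg_cst.
  by apply/funext => y; rewrite big_nil.
rewrite (_ : (fun _ => _) = fun y => f i y + \sum_(j <- r) f j y); last first.
  by apply/funext => y; rewrite big_cons.
exact: (cvgD (fc i x) IH).
Qed.

Lemma continuous_dotv (T : topologicalType) n (u v : T -> 'rV[R]_n) :
  (forall j, continuous (fun x => u x ord0 j)) ->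
  (forall j, continuous (fun x => v x ord0 j)) ->
  continuous (fun x => dotv (u x) (v x)).
Proof.
move=> uc vc; apply: continuous_sum => i x.
exact: (cvgM (uc i x) (vc i x)).
Qed.

End Continuity.

Section Dot.
Variables (R : realType) (n : nat).
Implicit Types u v : 'rV[R]_n.

Lemma dotvC u v : dotv u v = dotv v u.
Proof. by apply: eq_bigr => i _; rewrite mulrC. Qed.

Lemma dotvZl a u v : dotv (a *: u) v = a * dotv u v.
Proof. by rewrite /dotv mulr_sumr; apply: eq_bigr => i _; rewrite mxE mulrA. Qed.

Lemma dotvZr a u v : dotv u (a *: v) = a * dotv u v.
Proof. by rewrite dotvC dotvZl dotvC. Qed.

Lemma dotvNl u v : dotv (- u) v = - dotv u v.
Proof. by rewrite -scaleN1r dotvZl mulN1r. Qed.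

Lemma dotvNr u v : dotv u (- v) = - dotv u v.
Proof. by rewrite dotvC dotvNl dotvC. Qed.

Lemma dotv_gt0 u : u != 0 -> 0 < dotv u u.
Proof.
move=> u0; rewrite lt_neqAle; apply/andP; split; last first.
  by apply: sumr_ge0 => i _; rewrite -expr2 sqr_ge0.
rewrite eq_sym psumr_eq0; last by move=> i _; rewrite -expr2 sqr_ge0.
apply: contra u0 => /allP h; apply/eqP/rowP => i; rewrite mxE.
by have := h i (mem_index_enum i); rewrite mulf_eq0 orbb => /eqP.
Qed.

(** Normalization to a unit vector. *)
Definition unitv u : 'rV[R]_n := (Num.sqrt (dotv u u))^-1 *: u.

Lemma unitv_sphere u : u != 0 -> usphere R n (unitv u).
Proof.
move=> /dotv_gt0 u0; rewrite /usphere /= dotvZl dotvZr mulrA -expr2 exprVn.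
by rewrite sqr_sqrtr ?mulVf ?gt_eqF // ltW.
Qed.

Lemma unitvN u : unitv (- u) = - unitv u.
Proof. by rewrite /unitv dotvNl dotvNr opprK scalerN. Qed.

End Dot.

Section Embedding.
Variables (R : realType) (k d : nat).
Local Notation cube := 'rV[R]_(cube_dim k d).

(** A function vanishing on the boundary of the [i]-th cube. *)
Definition height (x : cube) (i : 'I_k) : R := \prod_(c < d) (1 - entry x i c ^+ 2).

(** A nonzero vector, equal to [(height x i, x_i)]. *)
Definition cone (x : cube) (i : 'I_k) : 'rV[R]_d.+1 :=
  \row_j (if unlift ord0 j is Some c then entry x i c else height x i).

Lemma cone_neq0 x i : cone x i != 0.
Proof.
apply/eqP => /rowP e.
have x0 c : entry x i c = 0 by have := e (lift ord0 c); rewrite !mxE liftK.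
have := e ord0; rewrite !mxE unlift_none /height big1 => [/eqP|c _].
  by rewrite oner_eq0.
by rewrite x0 expr0n subr0.
Qed.

Lemma continuous_entry i c : continuous (fun x : cube => entry x i c).
Proof. exact: coord_continuous. Qed.

Lemma continuous_cone i j : continuous (fun x : cube => cone x i ord0 j).
Proof.
rewrite (_ : (fun _ => _) =
    fun x => if unlift ord0 j is Some c then entry x i c else height x i); last first.
  by apply/funext => x; rewrite mxE.
case: (unlift ord0 j) => [c|]; first exact: continuous_entry.
apply: (@continuous_prod R cube 'I_d _ (fun c x => 1 - entry x i c ^+ 2)) => c x.
have xc := @continuous_entry i c x.
exact: (cvgB (@cvg_cst _ (1 : R) _ (nbhs x) _) (cvgM xc xc)).
Qed.

(** The map from the [i]-th cube to a hemisphere of [S^d], odd on the boundary of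
    the cube ([emb_antipodal]). *)
Definition emb (x : cube) (i : 'I_k) : 'rV[R]_d.+1 := unitv (cone x i).

Lemma emb_sphere x i : usphere R d.+1 (emb x i).
Proof. exact/unitv_sphere/cone_neq0. Qed.

Lemma continuous_emb i : continuous (emb^~ i).
Proof.
move=> x; apply: (@cvg_mx R cube (nbhs x) (nbhs_filter x) 1 d.+1) => i0 j; rewrite (ord1 i0).
rewrite (_ : (fun t => _) =
  fun t => (Num.sqrt (dotv (cone t i) (cone t i)))^-1 * cone t i ord0 j); last first.
  by apply/funext => t; rewrite !mxE.
rewrite [X in _ --> X]mxE.
apply: cvgM; last exact: continuous_cone.
apply: cvgV; first by rewrite gt_eqF // sqrtr_gt0 dotv_gt0 // cone_neq0.
have dc := @continuous_dotv R cube d.+1 (cone^~ i) (cone^~ i)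
  (@continuous_cone i) (@continuous_cone i).
exact: (continuous_comp (dc x) (@sqrt_continuous R _)).
Qed.

Lemma emb_antipodal i x y : antipodal_at i x y ->
  emb y i = - emb x i /\ forall j, j != i -> emb y j = emb x j.
Proof.
move=> [[c xc] yx yxj]; split; last first.
  move=> j ji; rewrite /emb; congr unitv; apply/rowP => l; rewrite !mxE.
  case: unlift => [c'|]; first exact: yxj.
  by apply: eq_bigr => c' _; rewrite yxj.
rewrite /emb -unitvN; congr unitv; apply/rowP => l; rewrite !mxE.
case: unlift => [c'|]; first exact: yx.
have h0 (z : cube) : `|entry z i c| = 1 -> height z i = 0.
  by move=> e; rewrite /height (bigD1 c) //= -real_normK ?num_real // e expr1n subrr mul0r.
by rewrite !h0 ?oppr0 // yx normrN.
Qed.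

End Embedding.

(** * Common zeros of odd functions *)

Lemma prod_pairs (k m : nat) (Q : comNzRingType) (F : 'I_k -> 'I_k -> Q) :
  \prod_(i < k) \prod_(j < k | (i < j)%N) F i j ^+ m =
  (\prod_(i < k) \prod_(j < k | (i < j)%N) F i j) ^+ m.
Proof. by rewrite -prodrXl; apply: eq_bigr => i _; rewrite prodrXl. Qed.

Lemma sum_pair (Q : comNzRingType) (I : finType) (F : I -> Q) (i j : I) : i != j ->
  \sum_(x | (x == i) (+) (x == j)) F x = F i + F j.
Proof.
move=> ij; rewrite (bigD1 i) /=; last by rewrite eqxx (negPf ij).
rewrite (bigD1 j) /=; last by rewrite eqxx eq_sym (negPf ij).
rewrite big1 ?addr0 // => x.
by case: (x == i); case: (x == j).
Qed.

Section CommonZeros.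
Variable R : realType.

Lemma continuous_odd_fun (T : topologicalType) n (f : 'rV[R]_n * 'rV[R]_n -> R)
    (u v : T -> 'rV[R]_n) : odd_fun f -> continuous u -> continuous v ->
  (forall x, usphere R n (u x)) -> (forall x, usphere R n (v x)) ->
  continuous (fun x => f (u x, v x)).
Proof.
move=> [fc _ _] uc vc us vs x.
have /subspace_continuousP/(_ (u x, v x)) := fc.
move=> /(_ (conj (us x) (vs x))) fx.
move=> B hB; have h := cvg_pair (uc x) (vc x) (fx B hB).
have h' := h (nbhs_filter x) (nbhs_filter (u x)) (nbhs_filter (v x)).
suff : nbhs x (fun y => B (f (u y, v y))) by [].
apply: (@filterS _ (nbhs x) (nbhs_filter x) _ _ _ h') => y /=.
by apply; split; [exact: us | exact: vs].
Qed.

Theorem sphere_common_zero (n m k : nat) (f : 'I_m -> 'rV[R]_n * 'rV[R]_n -> R) :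
  (0 < n)%N -> (forall l, odd_fun (f l)) ->
  ~ ideal_gen (fun i : 'I_k => PolyF2.t i ^+ n)
      (\prod_(i < k) \prod_(j < k | (i < j)%N) (PolyF2.t i + PolyF2.t j) ^+ m) ->
  exists e : 'I_k -> 'rV[R]_n, (forall i, usphere R n (e i)) /\ common_zero f e.
Proof.
case: n f => // d f _ fodd nI.
pose T := (('I_k * 'I_k) * 'I_m)%type.
(* With an exclusive or, the parity is also right for the pairs [(i, i)]. *)
pose chi (a : T) (i : 'I_k) := (i == a.1.1) (+) (i == a.1.2).
pose r := seq.filter (fun a : T => (a.1.1 < a.1.2)%N) (index_enum _).
pose g (a : T) (x : 'rV[R]_(cube_dim k d)) := f a.2 (emb x a.1.1, emb x a.1.2).
have [| | |x gx] := @borsuk_ulam_cubes R k d T chi r g.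
- move=> a; apply: continuous_odd_fun => //; try exact: continuous_emb;
  by move=> x; apply: emb_sphere.
- move=> [[i j] l] i0 x y /emb_antipodal[e1 e2]; rewrite /g /chi /=.
  have [_ oddl oddr] := fodd l.
  have S x' i' : emb x' i' \in usphere R d.+1 by apply/mem_set/emb_sphere.
  have [<-|ni] := eqVneq i0 i; have [<-|nj] := eqVneq i0 j.
  + by rewrite e1 oddl ?oddr ?opprK ?mul1r // -e1.
  + by rewrite e1 oddl // e2 1?eq_sym // expr1 mulN1r.
  + by rewrite e1 oddr // e2 1?eq_sym // expr1 mulN1r.
  + by rewrite !e2 1?eq_sym // mul1r.
- suff -> : \prod_(a <- r) \sum_(i | chi a i) PolyF2.t i =
     \prod_(i < k) \prod_(j < k | (i < j)%N) (PolyF2.t i + PolyF2.t j) ^+ m by [].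
  rewrite big_filter pair_big_dep /=.
  rewrite (eq_bigr (fun p : 'I_k * 'I_k => \prod_(l < m) (PolyF2.t p.1 + PolyF2.t p.2))).
    rewrite pair_big_dep /=; apply: eq_big => [[[i j] l] /=|[[i j] l] /= ij].
      by rewrite andbT.
    by apply: (@sum_pair (PolyF2.A k)); rewrite -val_eqE /= ltn_eqF.
  by move=> p _; rewrite prodr_const card_ord.
exists (emb x); split => [i|l i j ij]; first exact: emb_sphere.
by apply: (gx (i, j, l)); rewrite mem_filter ij mem_index_enum.
Qed.

Lemma odd_dotv n : odd_fun (fun p : 'rV[R]_n * 'rV[R]_n => dotv p.1 p.2).
Proof.
split=> [|x y _ _|x y _ _]; [|exact: dotvNl|exact: dotvNr].
apply: continuous_subspaceT; apply: continuous_dotv => j x.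
  exact: (continuous_comp (@cvg_fst _ _ _ _ _) (@coord_continuous R 1 n ord0 j _)).
exact: (continuous_comp (@cvg_snd _ _ _ _ _) (@coord_continuous R 1 n ord0 j _)).
Qed.

Theorem frame_common_zero (n m k : nat) (f : 'I_m -> 'rV[R]_n * 'rV[R]_n -> R) :
  (0 < n)%N -> (forall l, odd_fun (f l)) ->
  ~ ideal_gen (PolyF2.wbar_gens n (k := k))
      (\prod_(i < k) \prod_(j < k | (i < j)%N) (PolyF2.t i + PolyF2.t j) ^+ m) ->
  exists e : 'I_k -> 'rV[R]_n,
    [/\ forall i, usphere R n (e i), orthonormal_frame e & common_zero f e].
Proof.
move=> n0 fodd nJ.
(* Orthogonality is the vanishing of one more odd function. *)
pose f' (l : 'I_m.+1) := if unlift ord0 l is Some l' then f l'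
  else fun p : 'rV[R]_n * 'rV[R]_n => dotv p.1 p.2.
have [||e [es ez]] := @sphere_common_zero n m.+1 k f' n0.
- by move=> l; rewrite /f'; case: unlift => [l'|]; [exact: fodd | exact: odd_dotv].
- move=> h; apply: nJ; apply: vandermonde_colon.
  by rewrite prod_pairs -exprS -prod_pairs.
have orth (i j : 'I_k) : (i < j)%N -> dotv (e i) (e j) = 0.
  by move=> ij; have := ez ord0 _ _ ij; rewrite /f' unlift_none.
exists e; split=> // [i j|l i j ij].
  case: (ltngtP i j) => [ij|ji|/val_inj ->].
  - by rewrite orth // -val_eqE /= ltn_eqF.
  - by rewrite dotvC orth // -val_eqE /= gtn_eqF.
  - by rewrite eqxx; apply: es.
by have := ez (lift ord0 l) _ _ ij; rewrite /f' liftK.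
Qed.

End CommonZeros.

Lemma notin_ideal_half (r : nat) (Q : comNzRingType) (h : 'I_r -> Q) k m
    (F : 'I_k -> 'I_k -> Q) :
  ~ ideal_gen h (\prod_(i < k) \prod_(j < k | (i < j)%N) F i j ^+ (2 * m)) ->
  ~ ideal_gen h (\prod_(i < k) \prod_(j < k | (i < j)%N) F i j ^+ m).
Proof.
move=> n2 h1; apply: n2; rewrite prod_pairs mul2n -addnn exprD.
by apply: ideal_genM; rewrite -prod_pairs.
Qed.

Theorem theorem2 (R : realType) (n m k : nat)
    (n_gt0 : (0 < n)%N) (m_gt0 : (0 < m)%N) (k_gt0 : (0 < k)%N) :
  [/\ ~ ideal_gen (fun i : 'I_k => PolyF2.t i ^+ n)
          (\prod_(i < k) \prod_(j < k | (i < j)%N)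
             (PolyF2.t i + PolyF2.t j) ^+ (2 * m)) ->
        R_odd R (n, m, k),
      ~ ideal_gen (fun i : 'I_k => PolyF2.t i ^+ n)
          (\prod_(i < k) \prod_(j < k | (i < j)%N)
             (PolyF2.t i + PolyF2.t j) ^+ m) ->
        R_odd_sym R (n, m, k),
      ~ ideal_gen (PolyF2.wbar_gens n (k := k))
          (\prod_(i < k) \prod_(j < k | (i < j)%N)
             (PolyF2.t i + PolyF2.t j) ^+ (2 * m)) ->
        R_odd_orth R (n, m, k) &
      ~ ideal_gen (PolyF2.wbar_gens n (k := k))
          (\prod_(i < k) \prod_(j < k | (i < j)%N)
             (PolyF2.t i + PolyF2.t j) ^+ m) ->
        R_odd_sym_orth R (n, m, k)].
Proof.
split=> [/notin_ideal_half nI|nI|/notin_ideal_half nJ|nJ]; split=> // f fodd.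
- exact: sphere_common_zero nI.
- by move=> _; apply: sphere_common_zero nI.
- exact: frame_common_zero nJ.
- by move=> _; apply: frame_common_zero nJ.
Qed.
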